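(* For all integers $p\ge2$ and $m\ge1$, let $J_p=\sum_{k=1}^{p-1}k\cot\left(\frac{k\pi}{p}\right)$. Then there is a real number $\varepsilon_{p,m}$ with $0<\varepsilon_{p,m}<|b_{2m}|$ such that $$\pi J_p=-p^2\ln p+(\ln(2\pi)-\gamma)p^2-p-\sum_{k=1}^{m-1}\frac{b_{2k}\,\zeta(2k)}{k\cdot p^{2k-2}}+(-1)^m\frac{\zeta(2m)}{m\cdot p^{2m-2}}\,\varepsilon_{p,m}.$$
   Context: The Bernoulli polynomials $(B_n)_{n\ge 0}$ are the unique sequence of real polynomials with $B_0(X)=1$ and, for all $n\ge1$, $B_n(X+1)-B_n(X)=nX^{n-1}$ and $\int_0^1B_n(t)\,dt=0$; the Bernoulli numbers are $b_n=B_n(0)$. $\zeta$ is the Riemann zeta function and $\gamma$ is the Euler–Mascheroni constant. Empty sums are $0$. *)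

(* Defs.v *)
From Stdlib Require Import Reals Lra Lia ClassicalEpsilon.
From Coquelicot Require Import Coquelicot.
Open Scope R_scope.

Definition is_polynomial (f : R -> R) : Prop :=
  exists (N : nat) (a : nat -> R),
    forall x : R, f x = sum_n (fun i => a i * x ^ i) N.

(* Real polynomials are identified with the polynomial functions on R.  The
   lemmas [is_bernoulli_exists] and [is_bernoulli_unique] below show that
   exactly one sequence satisfies this predicate. *)
Definition is_bernoulli (B : nat -> R -> R) : Prop :=
  (forall n : nat, is_polynomial (B n)) /\
  (forall x : R, B 0%nat x = 1) /\
  (forall n : nat, (1 <= n)%nat ->
    (forall x : R, B n (x + 1) - B n x = INR n * x ^ (n - 1)) /\
    is_RInt (B n) 0 1 0).

Definition bernoulli_number (B : nat -> R -> R) (n : nat) : R := B n 0.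

(* The Riemann zeta function on the half-line s > 1, where the series
   converges. *)
Definition zeta (s : R) : R :=
  Series (fun n => / Rpower (INR (S n)) s).

Definition euler_gamma : R :=
  real (Lim_seq (fun n => sum_n_m (fun k => / INR k) 1 n - ln (INR n))).

Definition cot (x : R) : R := cos x / sin x.

(* [sum_n_m f a b] is the sum over a <= k <= b, and 0 when b < a. *)
Definition J (p : nat) : R :=
  sum_n_m (fun k => INR k * cot (INR k * PI / INR p)) 1 (p - 1).

Local Ltac rring :=
  match goal with |- @eq _ ?a ?b => change (@eq R a b) end;
  repeat match goal with
    |- context [match ?n with O => 1 | S _ => INR ?n + 1 end] =>
    change (match n with O => 1 | S _ => INR n + 1 end) with (INR (S n))
  end;
  repeat match goal with |- context [@sum_n ?G ?a ?n] =>
    let s := fresh in pose (s := @sum_n G a n : R);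
    change (@sum_n G a n) with s; clearbody s
  end;
  ring.

Lemma sum_n_SR (a : nat -> R) (n : nat) :
  (sum_n a (S n) : R) = (sum_n a n : R) + a (S n).
Proof. exact (sum_Sn a n). Qed.

Lemma sum_n_OR (a : nat -> R) : (sum_n a 0 : R) = a O.
Proof. exact (sum_O a). Qed.

Lemma polynomial_antiderivative (f : R -> R) :
  is_polynomial f ->
  exists F, is_polynomial F /\ F 0 = 0 /\ forall x, is_derive F x (f x).
Proof.
intros [N [a Hf]].
exists (fun x => sum_n (fun i => a i / INR (S i) * x ^ S i) N).
split; [|split].
- exists (S N), (fun j => match j with O => 0 | S i => a i / INR (S i) end).
  intros x. unfold sum_n. rewrite (sum_Sn_m _ 0 (S N)) by lia.
  rewrite <- sum_n_m_S. rewrite Rmult_0_l. unfold plus; simpl.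
  now rewrite Rplus_0_l.
- rewrite (sum_n_ext _ (fun _ => 0)).
  + rewrite sum_n_const. rring.
  + intros i. simpl pow. rring.
- intros x. rewrite Hf.
  apply (is_derive_sum_n (fun i x => a i / INR (S i) * x ^ S i)
           N x (fun i => a i * x ^ i)).
  intros i _. auto_derive; [exact I|].
  change (match i with O => 1 | S _ => INR i + 1 end) with (INR (S i)).
  replace (Init.Nat.pred (S i)) with i by reflexivity.
  field. apply not_0_INR. lia.
Qed.

Lemma polynomial_derivative (N : nat) (a : nat -> R) (x : R) :
  is_derive (fun x => sum_n (fun i => a i * x ^ i) (S N)) x
    (sum_n (fun i => INR (S i) * a (S i) * x ^ i) N).
Proof.
replace (sum_n (fun i => INR (S i) * a (S i) * x ^ i) N)
  with (sum_n (fun i => INR i * a i * x ^ (Init.Nat.pred i)) (S N)).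
- apply (is_derive_sum_n (fun i x => a i * x ^ i) (S N) x
           (fun i => INR i * a i * x ^ (Init.Nat.pred i))).
  intros i _. auto_derive; [exact I|]. rring.
- unfold sum_n. rewrite (sum_Sn_m _ 0 (S N)) by lia.
  rewrite <- sum_n_m_S. simpl INR at 1. rewrite !Rmult_0_l.
  unfold plus; simpl. now rewrite Rplus_0_l.
Qed.

Lemma is_derive_eq_const (f : R -> R) (c : R) :
  (forall x, is_derive f x c) -> forall x, f x = f 0 + c * x.
Proof.
intros H x.
assert (H1 := is_RInt_derive f (fun _ => c) 0 x (fun t _ => H t)
                (fun t _ => continuous_const c t)).
assert (H2 := is_RInt_const 0 x c).
assert (E := eq_trans (eq_sym (is_RInt_unique _ _ _ _ H1))
               (is_RInt_unique _ _ _ _ H2)).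
unfold minus, plus, opp, scal in E; simpl in E.
unfold mult in E; simpl in E. lra.
Qed.

Lemma periodic_polynomial_const (f : R -> R) :
  is_polynomial f -> (forall x, f (x + 1) = f x) -> forall x, f x = f 0.
Proof.
intros [N [a Hf]]. revert f a Hf.
induction N as [|N IH]; intros f a Hf Hp.
- intros x. rewrite !Hf, !sum_n_OR. simpl. rring.
- set (g := fun x => sum_n (fun i => INR (S i) * a (S i) * x ^ i) N).
  assert (Hd : forall x, is_derive f x (g x)).
  { intros x. apply (is_derive_ext _ _ _ _ (fun t => eq_sym (Hf t))).
    apply polynomial_derivative. }
  assert (Hg : forall x, g x = g 0).
  { apply (IH g _ (fun x => eq_refl)). intros x.
    assert (H1 : is_derive (fun t => f (t + 1)) x (g (x + 1))).
    { evar_last.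
      - apply (is_derive_comp f (fun t => t + 1) x (g (x + 1)) 1).
        + apply Hd.
        + auto_derive; [exact I|rring].
      - unfold scal; simpl; unfold mult; simpl. rring. }
    assert (H2 : is_derive (fun t => f (t + 1)) x (g x)).
    { apply (is_derive_ext f); [intros t; now rewrite Hp|apply Hd]. }
    now rewrite <- (is_derive_unique _ _ _ H1), <- (is_derive_unique _ _ _ H2). }
  assert (Hl := is_derive_eq_const f (g 0)
                  (fun x => eq_rect _ (is_derive f x) (Hd x) _ (Hg x))).
  assert (H0 := Hp 0). rewrite (Hl (0 + 1)) in H0.
  intros x. rewrite (Hl x). replace (g 0) with 0 by lra. rring.
Qed.

Lemma is_polynomial_affine (c d : R) (f : R -> R) :
  is_polynomial f -> is_polynomial (fun x => c * (f x + d)).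
Proof.
intros [N [a Hf]].
exists N, (fun i => c * match i with O => a O + d | S _ => a i end).
intros x. rewrite Hf. clear f Hf.
induction N as [|N IH].
- rewrite !sum_n_OR. simpl. rring.
- rewrite !sum_n_SR. rewrite <- IH. cbn -[sum_n]. rring.
Qed.

Lemma is_polynomial_minus (f g : R -> R) :
  is_polynomial f -> is_polynomial g -> is_polynomial (fun x => f x - g x).
Proof.
assert (pad : forall h, is_polynomial h -> exists N, forall M, (N <= M)%nat ->
  exists a, forall x, h x = sum_n (fun i => a i * x ^ i) M).
{ intros h [N [a Hh]]. exists N. intros M HM.
  exists (fun i => if Nat.leb i N then a i else 0). intros x. rewrite Hh.
  induction HM as [|M HM IH].
  - apply sum_n_ext_loc. intros i Hi.
    now rewrite (proj2 (Nat.leb_le i N) Hi).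
  - rewrite sum_n_SR, <- IH.
    rewrite (proj2 (Nat.leb_gt (S M) N)) by lia.
    cbn -[sum_n]. rring. }
intros Hf Hg.
destruct (pad f Hf) as [N HN]. destruct (pad g Hg) as [M HM].
destruct (HN (N + M)%nat) as [a Ha]; [lia|].
destruct (HM (N + M)%nat) as [b Hb]; [lia|].
exists (N + M)%nat, (fun i => a i - b i). intros x. rewrite Ha, Hb.
generalize (N + M)%nat as K. induction K as [|K IH].
- rewrite !sum_n_OR. rring.
- rewrite !sum_n_SR, <- IH. cbn -[sum_n]. rring.
Qed.

Lemma polynomial_continuous (f : R -> R) :
  is_polynomial f -> forall x, continuous f x.
Proof.
intros [N [a Hf]] x.
apply (continuous_ext _ f x (fun t => eq_sym (Hf t))).
apply (ex_derive_continuous (fun x => sum_n (fun i => a i * x ^ i) N)).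
exists (sum_n (fun i => a i * (INR i * x ^ Init.Nat.pred i)) N).
apply (is_derive_sum_n (fun i x => a i * x ^ i)).
intros i _. auto_derive; [exact I|]. rring.
Qed.

Lemma bernoulli_step (n : nat) (f : R -> R) :
  is_polynomial f ->
  exists g, is_polynomial g /\ is_RInt g 0 1 0 /\
    (forall x, is_derive g x (INR (S n) * f x)).
Proof.
intros Hf.
destruct (polynomial_antiderivative f Hf) as [F [PF [F0 DF]]].
destruct (polynomial_antiderivative F PF) as [G [PG [G0 DG]]].
exists (fun x => INR (S n) * (F x + - G 1)).
split; [|split].
- now apply is_polynomial_affine.
- assert (H : forall x, is_derive (fun x => INR (S n) * (G x + - (G 1 * x))) x
                (INR (S n) * (F x + - G 1))).
  { intros x. auto_derive.
    - repeat split. eexists. apply DG.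
    - change (Derive (fun t => G t) x) with (Derive G x).
      rewrite (is_derive_unique G x (F x) (DG x)). rring. }
  evar_last.
  + apply (is_RInt_derive (fun x => INR (S n) * (G x + - (G 1 * x)))).
    * intros x _. apply H.
    * intros x _.
      apply (polynomial_continuous (fun x => INR (S n) * (F x + - G 1))).
      now apply is_polynomial_affine.
  + unfold minus, plus, opp; simpl. rewrite G0. rring.
- intros x. auto_derive.
  + repeat split. eexists. apply DF.
  + change (Derive (fun t => F t) x) with (Derive F x).
    rewrite (is_derive_unique F x (f x) (DF x)). rring.
Qed.

Lemma is_bernoulli_exists : exists B, is_bernoulli B.
Proof.
assert (st : forall (n : nat) (f : {f : R -> R | is_polynomial f}),
  {g : {g : R -> R | is_polynomial g} | is_RInt (proj1_sig g) 0 1 0 /\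
     forall x, is_derive (proj1_sig g) x (INR (S n) * proj1_sig f x)}).
{ intros n [f Hf].
  apply ClassicalEpsilon.constructive_indefinite_description.
  destruct (bernoulli_step n f Hf) as [g [Pg Hg]].
  now exists (exist _ g Pg). }
assert (P1 : is_polynomial (fun _ => 1)).
{ exists O, (fun _ => 1). intros x. rewrite sum_n_OR. simpl. rring. }
set (b := nat_rect (fun _ => {f : R -> R | is_polynomial f})
            (exist _ (fun _ => 1) P1) (fun n f => proj1_sig (st n f))).
exists (fun n => proj1_sig (b n)).
assert (Hs : forall n, is_RInt (proj1_sig (b (S n))) 0 1 0 /\
  forall x, is_derive (proj1_sig (b (S n))) x (INR (S n) * proj1_sig (b n) x)).
{ intros n. exact (proj2_sig (st n (b n))). }
assert (H1 : forall n,
  proj1_sig (b (S n)) 1 - proj1_sig (b (S n)) 0 = match n with O => 1 | _ => 0 end).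
{ intros n.
  assert (I1 : is_RInt (fun x => INR (S n) * proj1_sig (b n) x) 0 1
                 (proj1_sig (b (S n)) 1 - proj1_sig (b (S n)) 0)).
  { apply (is_RInt_derive (proj1_sig (b (S n)))).
    - intros x _. apply Hs.
    - intros x _. apply (continuous_scal_r (INR (S n)) (proj1_sig (b n))).
      apply polynomial_continuous. exact (proj2_sig (b n)). }
  assert (I2 : is_RInt (proj1_sig (b n)) 0 1 (match n with O => 1 | _ => 0 end)).
  { destruct n as [|n]; [|apply Hs].
    evar_last; [apply (is_RInt_const 0 1 1)|].
    unfold scal; simpl; unfold mult; simpl. rring. }
  apply (is_RInt_scal _ _ _ (INR (S n))) in I2.
  rewrite <- (is_RInt_unique _ _ _ _ I1).
  etransitivity; [exact (is_RInt_unique _ _ _ _ I2)|].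
  unfold scal; simpl; unfold mult; simpl. destruct n; simpl; rring. }
split; [|split].
- intros n. exact (proj2_sig (b n)).
- reflexivity.
- intros n Hn. destruct n as [|n]; [lia|]. clear Hn.
  split; [|apply Hs]. replace (S n - 1)%nat with n by lia.
  induction n as [|n IH]; intros x.
  + assert (D : forall y, is_derive (proj1_sig (b 1%nat)) y 1).
    { intros y. evar_last; [apply (Hs O)|]. simpl. rring. }
    rewrite (is_derive_eq_const _ _ D (x + 1)).
    rewrite (is_derive_eq_const _ _ D x). simpl. rring.
  + assert (D : forall y, is_derive
      (fun t => proj1_sig (b (S (S n))) (t + 1) - proj1_sig (b (S (S n))) t
                - INR (S (S n)) * t ^ S n) y 0).
    { intros y.
      set (h := proj1_sig (b (S (S n)))).
      assert (Dh := fun z => proj2 (Hs (S n)) z). fold h in Dh.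
      assert (D1 : forall z, Derive h z = INR (S (S n)) * proj1_sig (b (S n)) z)
        by (intros z; apply is_derive_unique, Dh).
      assert (E1 : forall z, ex_derive h z) by (intros z; eexists; apply Dh).
      auto_derive.
      - repeat split; apply E1.
      - change (Derive (fun t => h t)) with (Derive h).
        rewrite !D1. specialize (IH y).
        replace (Init.Nat.pred (S n)) with n by reflexivity.
        change (match n with O => 1 | S _ => INR n + 1 end) with (INR (S n)).
        change (match S n with O => 1 | S _ => INR (S n) + 1 end) with (INR (S (S n))).
        replace (proj1_sig (b (S n)) (y + 1))
          with (proj1_sig (b (S n)) y + INR (S n) * y ^ n) by lra.
        rewrite (S_INR (S n)). rring. }
    assert (E := is_derive_eq_const _ _ D x). cbv beta in E.
    rewrite Rplus_0_l, (H1 (S n)), pow_i in E by lia. lra.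
Qed.

Lemma is_bernoulli_unique (B C : nat -> R -> R) :
  is_bernoulli B -> is_bernoulli C -> forall n x, B n x = C n x.
Proof.
intros [PB [B0 HB]] [PC [C0 HC]] n x.
destruct n as [|n]; [now rewrite B0, C0|].
destruct (HB (S n)) as [B1 B2]; [lia|].
destruct (HC (S n)) as [C1 C2]; [lia|].
assert (K : forall y, B (S n) y - C (S n) y = B (S n) 0 - C (S n) 0).
{ apply (periodic_polynomial_const (fun y => B (S n) y - C (S n) y)).
  - now apply is_polynomial_minus.
  - intros y. specialize (B1 y). specialize (C1 y). lra. }
assert (I1 := is_RInt_minus _ _ _ _ _ _ B2 C2).
apply (is_RInt_ext _ (fun _ => B (S n) 0 - C (S n) 0)) in I1.
2: { intros y _. rewrite <- (K y). reflexivity. }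
assert (I2 := is_RInt_const 0 1 (B (S n) 0 - C (S n) 0)).
assert (E := eq_trans (eq_sym (is_RInt_unique _ _ _ _ I1))
               (is_RInt_unique _ _ _ _ I2)).
unfold minus, plus, opp, scal in E; simpl in E.
unfold mult in E; simpl in E.
specialize (K x). lra.
Qed.

(* Main.v *)
Require Import Defs.
From Stdlib Require Import Reals Factorial Lra Lia.
From Coquelicot Require Import Coquelicot.
Open Scope R_scope.

(** Write [D n = H_n - ln n - gamma - 1/(2n)].  Integrating by parts against
    Bernoulli polynomials, the remainder of the Euler-Maclaurin expansion of
    [D n] to order [m] is a telescoping sum of the integrals of
    [(B_2m(x) - b_2m) / (n + x)^(2m+1)] over [0, 1], whose sign is [(-1)^m];
    since consecutive remainders have opposite signs, each is smaller in
    absolute value than the first omitted term.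

    On the other hand the partial fractions of the cotangent turn [PI * J p]
    into a limit of sums of harmonic numbers [H_(l p)], which gives the exact
    formula
    [PI * J p = - p^2 ln p + (ln (2 PI) - gamma) p^2 - p + 2 p^2 sum_(n>=1) D (n p)].
    Summing the expansions of [D (n p)] over [n] yields the statement.

    Both the partial fractions and Wallis' product come from the recursion in
    [n] of the integrals of [cos (2 x t) cos(t)^n] over [0, PI/2], and the case
    [p = 1], where [J 1 = 0], gives the convergence in Stirling's formula. *)

(** * Bernoulli polynomials *)

Lemma is_RInt_derive_le (F f : R -> R) (a b : R) :
  a <= b ->
  (forall x, a <= x <= b -> is_derive F x (f x)) ->
  (forall x, a <= x <= b -> continuous f x) ->
  is_RInt f a b (F b - F a).
Proof.
intros Hab HF Hf.
apply (is_RInt_derive F f a b);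
  intros x; rewrite Rmin_left, Rmax_right by lra; auto.
Qed.

Lemma is_RInt_eq (f : R -> R) (a b u v : R) :
  is_RInt f a b u -> is_RInt f a b v -> u = v.
Proof.
intros Hu Hv.
now rewrite <- (is_RInt_unique _ _ _ _ Hu), <- (is_RInt_unique _ _ _ _ Hv).
Qed.

Lemma is_RInt_gt_0 (f : R -> R) (a b l : R) :
  a < b ->
  (forall x, a < x < b -> 0 < f x) ->
  (forall x, a <= x <= b -> continuous f x) ->
  is_RInt f a b l -> 0 < l.
Proof.
intros Hab Hf Hc Hl. rewrite <- (is_RInt_unique _ _ _ _ Hl).
now apply RInt_gt_0.
Qed.

Lemma MVT_is_derive (f f' : R -> R) (a b : R) :
  a < b -> (forall c, a <= c <= b -> is_derive f c (f' c)) ->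
  exists c, f b - f a = f' c * (b - a) /\ a < c < b.
Proof.
intros Hab Hf. apply MVT_cor2; [exact Hab|].
intros c Hc. now apply is_derive_Reals, Hf.
Qed.

Lemma is_polynomial_Derive (f : R -> R) :
  is_polynomial f ->
  is_polynomial (Derive f) /\ forall x, is_derive f x (Derive f x).
Proof.
intros [[|N] [a Hf]].
- assert (D : forall x, is_derive f x 0).
  { intros x. apply (is_derive_ext (fun _ => a O)).
    - intros t. rewrite Hf, sum_n_OR. simpl. ring.
    - apply (is_derive_const (a O)). }
  split.
  + exists O, (fun _ => 0). intros x.
    rewrite (is_derive_unique _ _ _ (D x)), sum_n_OR. simpl. ring.
  + intros x. now rewrite (is_derive_unique _ _ _ (D x)).
- assert (D : forall x, is_derive f x
      (sum_n (fun i => INR (S i) * a (S i) * x ^ i) N)).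
  { intros x. apply (is_derive_ext _ _ _ _ (fun t => eq_sym (Hf t))).
    apply polynomial_derivative. }
  split.
  + exists N, (fun i => INR (S i) * a (S i)).
    intros x. now apply is_derive_unique.
  + intros x. now rewrite (is_derive_unique _ _ _ (D x)).
Qed.

Lemma is_derive_shift (f f' : R -> R) (c x : R) :
  (forall y, is_derive f y (f' y)) ->
  is_derive (fun y => f (y + c)) x (f' (x + c)).
Proof.
intros Hf.
assert (D : Derive (fun t => f t) (x + c) = f' (x + c))
  by (apply is_derive_unique, Hf).
auto_derive.
- repeat split. eexists. apply Hf.
- rewrite D. ring.
Qed.

(* The sequence [B' (n+1) / (n+1)] satisfies the defining conditions of the
   Bernoulli sequence, hence coincides with it. *)
Lemma bernoulli_derive (B : nat -> R -> R) :
  is_bernoulli B ->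
  forall n x, is_derive (B (S n)) x (INR (S n) * B n x).
Proof.
intros HB. pose proof HB as [PB [B0 HS]].
assert (HN : forall n, INR (S n) <> 0) by (intros n; apply not_0_INR; lia).
assert (DB := fun n => is_polynomial_Derive _ (PB n)).
assert (D1 : forall n x,
  Derive (B (S n)) (x + 1) - Derive (B (S n)) x = INR (S n) * (INR n * x ^ (n - 1))).
{ intros n x.
  assert (Dl := is_derive_minus _ _ _ _ _
    (is_derive_shift _ _ 1 x (proj2 (DB (S n)))) (proj2 (DB (S n)) x)).
  assert (Dr : is_derive (fun y => INR (S n) * y ^ n) x
                 (INR (S n) * (INR n * x ^ (n - 1)))).
  { auto_derive; [exact I|]. replace (Init.Nat.pred n) with (n - 1)%nat by lia.
    change (match n with O => 1 | S _ => INR n + 1 end) with (INR (S n)). ring. }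
  apply (is_derive_ext _ (fun y => INR (S n) * y ^ n)) in Dl.
  - rewrite <- (is_derive_unique _ _ _ Dr).
    now rewrite (is_derive_unique _ _ _ Dl).
  - intros t. destruct (HS (S n)) as [H1 _]; [lia|].
    specialize (H1 t). replace (S n - 1)%nat with n in H1 by lia. exact H1. }
(* The summand [0] puts each term in the shape required by [is_polynomial_affine]. *)
assert (HC : is_bernoulli (fun n x => / INR (S n) * (Derive (B (S n)) x + 0))).
{ split; [|split].
  - intros n. apply is_polynomial_affine, DB.
  (* [Derive (B 1)] is a periodic polynomial, hence constant, and [B 1 1 - B 1 0 = 1] forces the
     constant to be [1]. *)
  - assert (P : forall x, Derive (B 1%nat) x = Derive (B 1%nat) 0).
    { apply periodic_polynomial_const; [apply DB|].
      intros x. specialize (D1 O x). simpl in D1. lra. }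
    assert (E := is_derive_eq_const (B 1%nat) (Derive (B 1%nat) 0)
      (fun x => eq_rect _ (is_derive (B 1%nat) x) (proj2 (DB 1%nat) x) _ (P x)) 1).
    destruct (HS 1%nat) as [H1 _]; [lia|].
    specialize (H1 0). rewrite Rplus_0_l in H1. simpl in H1.
    intros x. rewrite P. simpl. lra.
  - intros n Hn. split.
    + intros x. specialize (D1 n x).
      replace (Derive (B (S n)) (x + 1))
        with (Derive (B (S n)) x + INR (S n) * (INR n * x ^ (n - 1))) by lra.
      field. apply HN.
    + evar_last.
      * apply (is_RInt_derive_le (fun x => / INR (S n) * B (S n) x)); [lra| |].
        -- intros x _. assert (Dx := proj2 (DB (S n)) x).
           apply (is_derive_scal _ _ (/ INR (S n))) in Dx.
           rewrite Rplus_0_r. exact Dx.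
        -- intros x _. apply polynomial_continuous, is_polynomial_affine, DB.
      * destruct (HS (S n)) as [H1 _]; [lia|].
        specialize (H1 0). rewrite Rplus_0_l, pow_i in H1 by lia.
        simpl. rewrite <- Rmult_minus_distr_l, H1. ring. }
intros n x.
rewrite <- (is_bernoulli_unique _ _ HC HB n x).
evar_last; [apply (proj2 (DB (S n)) x)|]. simpl. field. apply HN.
Qed.

(** Induction on the degree: the difference [h] of the two sides has derivative zero by the previous
    case, and its integral over [0, 1] is zero, so the constant is zero. *)
Lemma bernoulli_reflect (B : nat -> R -> R) (n : nat) (x : R) :
  is_bernoulli B -> B n (1 - x) = (-1) ^ n * B n x.
Proof.
intros HB. assert (DB := bernoulli_derive B HB).
pose proof HB as [_ [B0 HS]].
revert x. induction n as [|n IH]; intros x.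
{ rewrite !B0. simpl. ring. }
set (s := (-1) ^ S n).
set (h := fun x => B (S n) (1 - x) - s * B (S n) x).
assert (Dh : forall y, is_derive h y 0).
{ intros y. unfold h.
  assert (E : forall z, Derive (fun t => B (S n) t) z = INR (S n) * B n z)
    by (intros z; apply is_derive_unique, DB).
  auto_derive.
  - repeat split; eexists; apply DB.
  - rewrite !E. specialize (IH y). unfold Rminus in IH. rewrite IH.
    unfold s. cbn [pow]. ring. }
assert (Ch := is_derive_eq_const h 0 Dh).
destruct (HS (S n)) as [_ I1]; [lia|].
assert (I2 : is_RInt (fun y => B (S n) (1 - y)) 0 1 0).
(* Substitution [y -> 1 - y]: the reversed bounds are swapped back, and the factor [-1] is removed
   by a second scaling. *)
{ assert (I3 : is_RInt (fun y => scal (-1) (B (S n) (-1 * y + 1))) 0 1 (opp 0)).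
  { apply (is_RInt_comp_lin (B (S n)) (-1) 1 0 1).
    replace (-1 * 0 + 1) with 1 by ring. replace (-1 * 1 + 1) with 0 by ring.
    exact (is_RInt_swap _ _ _ _ I1). }
  apply (is_RInt_scal _ _ _ (-1)) in I3.
  evar_last.
  - eapply is_RInt_ext; [|exact I3]. intros y _.
    unfold scal; simpl; unfold mult; simpl.
    replace (-1 * y + 1) with (1 - y) by ring. ring.
  - unfold scal, opp; simpl; unfold mult; simpl. ring. }
assert (I4 := is_RInt_minus _ _ _ _ _ _ I2 (is_RInt_scal _ _ _ s _ I1)).
assert (I5 : is_RInt (fun _ => h 0) 0 1 (h 0)).
{ evar_last; [apply (is_RInt_const 0 1 (h 0))|].
  unfold scal; simpl; unfold mult; simpl. ring. }
apply (is_RInt_ext _ (fun _ => h 0)) in I4.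
- assert (E := is_RInt_eq _ _ _ _ _ I4 I5).
  unfold minus, plus, opp, scal in E; simpl in E; unfold mult in E; simpl in E.
  specialize (Ch x). unfold h in Ch at 1. lra.
- intros y _. transitivity (h y); [reflexivity|]. rewrite (Ch y), Rmult_0_l. apply Rplus_0_r.
Qed.

Lemma bernoulli_at_1 (B : nat -> R -> R) (n : nat) :
  is_bernoulli B -> (2 <= n)%nat -> B n 1 = B n 0.
Proof.
intros [_ [_ HS]] Hn. destruct (HS n) as [H1 _]; [lia|].
specialize (H1 0). rewrite Rplus_0_l, pow_i in H1 by lia. lra.
Qed.

Lemma pow_m1_sqr (n : nat) : (-1) ^ n * (-1) ^ n = 1.
Proof. rewrite <- Rpow_mult_distr. replace (-1 * -1) with 1 by ring. apply pow1. Qed.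

Lemma pow_m1_odd (m : nat) : (-1) ^ (2 * m + 1) = -1.
Proof. rewrite pow_add, pow_1_even. ring. Qed.

Lemma bernoulli_odd_at_0 (B : nat -> R -> R) (m : nat) :
  is_bernoulli B -> (1 <= m)%nat -> B (2 * m + 1)%nat 0 = 0.
Proof.
intros HB Hm. assert (H := bernoulli_reflect B (2 * m + 1) 0 HB).
rewrite pow_m1_odd, Rminus_0_r, bernoulli_at_1 in H by (auto; lia). lra.
Qed.

Lemma bernoulli_odd_at_half (B : nat -> R -> R) (m : nat) :
  is_bernoulli B -> B (2 * m + 1)%nat (1 / 2) = 0.
Proof.
intros HB. assert (H := bernoulli_reflect B (2 * m + 1) (1 / 2) HB).
rewrite pow_m1_odd in H. replace (1 - 1 / 2) with (1 / 2) in H by field. lra.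
Qed.

(** If [f x >= 0], the mean slope [f' c] on [a, x] is nonnegative, so the mean slope [f' d] on
    [x, b] is positive because [f'] increases from [c] to [d]; then [f b > 0], a contradiction. *)
Lemma strictly_convex_neg (f f' f'' : R -> R) (a b : R) :
  (forall x, is_derive f x (f' x)) -> (forall x, is_derive f' x (f'' x)) ->
  (forall x, a < x < b -> 0 < f'' x) -> f a = 0 -> f b = 0 ->
  forall x, a < x < b -> f x < 0.
Proof.
intros D1 D2 H2 Ha Hb x Hx.
destruct (MVT_is_derive f f' a x) as [c [Ec Hc]]; [lra|auto|].
destruct (MVT_is_derive f f' x b) as [d [Ed Hd]]; [lra|auto|].
destruct (MVT_is_derive f' f'' c d) as [e [Ee He]]; [lra|auto|].
assert (0 < f'' e) by (apply H2; lra).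
assert (0 < f'' e * (d - c)) by (apply Rmult_lt_0_compat; lra).
apply Rnot_le_lt. intros Hpos.
assert (0 <= f' c).
{ apply Rnot_lt_le. intros H1.
  assert (0 < - f' c * (x - a)) by (apply Rmult_lt_0_compat; lra). lra. }
assert (0 < f' d * (b - x)) by (apply Rmult_lt_0_compat; lra). lra.
Qed.

(** Induction by two degrees. [B_(2m+3)] vanishes at 0 and 1/2, and its second derivative is a
    positive multiple of [B_(2m+1)], of known sign on the interval; up to that sign it is strictly
    convex, so its own sign is the opposite one. *)
Lemma bernoulli_odd_sign (B : nat -> R -> R) (m : nat) :
  is_bernoulli B ->
  forall x, 0 < x < 1 / 2 -> 0 < (-1) ^ S m * B (2 * m + 1)%nat x.
Proof.
intros HB. assert (DB := bernoulli_derive B HB).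
induction m as [|m IH]; intros x Hx.
- assert (D : forall y, is_derive (B 1%nat) y 1).
  { intros y. evar_last; [apply (DB O)|].
    destruct HB as [_ [B0 _]]. rewrite B0. simpl. ring. }
  assert (E := is_derive_eq_const _ _ D).
  assert (H := bernoulli_odd_at_half B 0 HB). simpl in H |- *.
  rewrite E in H. rewrite E. lra.
- assert (E1 : B (2 * S m + 1)%nat 0 = 0) by (apply bernoulli_odd_at_0; [auto|lia]).
  assert (E2 := bernoulli_odd_at_half B (S m) HB).
  replace (2 * S m + 1)%nat with (S (S (2 * m + 1))) in * by lia.
  set (n := (2 * m + 1)%nat) in *.
  set (s := (-1) ^ S m) in *.
  assert (Hn : 0 < INR (S n) * INR (S (S n)))
    by (apply Rmult_lt_0_compat; apply lt_0_INR; lia).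
  assert (H : s * B (S (S n)) x < 0).
  { apply (strictly_convex_neg
      (fun x => s * B (S (S n)) x)
      (fun x => s * (INR (S (S n)) * B (S n) x))
      (fun x => s * (INR (S (S n)) * (INR (S n) * B n x))) 0 (1 / 2)); auto.
    - intros y. apply (is_derive_scal (B (S (S n)))), DB.
    - intros y. apply (is_derive_scal (fun y => INR (S (S n)) * B (S n) y)).
      apply (is_derive_scal (B (S n))), DB.
    - intros y Hy.
      replace (s * (INR (S (S n)) * (INR (S n) * B n y)))
        with (INR (S n) * INR (S (S n)) * (s * B n y)) by ring.
      apply Rmult_lt_0_compat; auto.
    - rewrite E1. ring.
    - rewrite E2. ring. }
  change ((-1) ^ S (S m)) with (-1 * s). lra.
Qed.

(** On (0, 1/2] the mean value theorem reduces the claim to the sign of [B_(2m-1)]; reflection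
    carries it to the other half. *)
Lemma bernoulli_even_sign (B : nat -> R -> R) (m : nat) (x : R) :
  is_bernoulli B -> (1 <= m)%nat -> 0 < x < 1 ->
  0 < (-1) ^ m * (B (2 * m)%nat x - B (2 * m)%nat 0).
Proof.
intros HB Hm. assert (DB := bernoulli_derive B HB).
assert (L : forall y, 0 < y <= 1 / 2 ->
  0 < (-1) ^ m * (B (2 * m)%nat y - B (2 * m)%nat 0)).
{ intros y Hy. destruct m as [|m]; [lia|].
  replace (2 * S m)%nat with (S (2 * m + 1)) by lia.
  destruct (MVT_is_derive (B (S (2 * m + 1))) _ 0 y (proj1 Hy)
    (fun c _ => DB _ c)) as [c [-> Hc]].
  replace ((-1) ^ S m * (INR (S (2 * m + 1)) * B (2 * m + 1)%nat c * (y - 0)))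
    with (INR (S (2 * m + 1)) * y * ((-1) ^ S m * B (2 * m + 1)%nat c)) by ring.
  apply Rmult_lt_0_compat.
  - apply Rmult_lt_0_compat; [apply lt_0_INR; lia|lra].
  - apply bernoulli_odd_sign; [auto|lra]. }
intros Hx. destruct (Rle_dec x (1 / 2)); [apply L; lra|].
assert (H := bernoulli_reflect B (2 * m) x HB).
rewrite pow_1_even, Rmult_1_l in H. rewrite <- H. apply L. lra.
Qed.

(** [B_2m] has mean zero on [0, 1], so integrating [bernoulli_even_sign] leaves only the constant
    [- (-1)^m b_2m]. *)
Lemma bernoulli_number_sign (B : nat -> R -> R) (m : nat) :
  is_bernoulli B -> (1 <= m)%nat -> 0 < (-1) ^ S m * B (2 * m)%nat 0.
Proof.
intros HB Hm.
set (s := (-1) ^ m). set (b := B (2 * m)%nat 0).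
destruct (proj2 (proj2 HB) (2 * m)%nat) as [_ I1]; [lia|].
apply (is_RInt_gt_0 (fun x => s * (B (2 * m)%nat x - b)) 0 1); [lra| | |].
- intros x Hx. now apply bernoulli_even_sign.
- intros x _. apply polynomial_continuous.
  apply (is_polynomial_affine s (- b)), HB.
- evar_last.
  + apply (is_RInt_scal (fun x => B (2 * m)%nat x - b) 0 1 s).
    apply (is_RInt_minus (B (2 * m)%nat) (fun _ => b) 0 1); [apply I1|].
    apply is_RInt_const.
  + unfold minus, plus, opp, scal; simpl; unfold mult; simpl.
    unfold s. ring.
Qed.

(** * Euler-Maclaurin remainders of the harmonic numbers *)

Lemma sum1_0 (f : nat -> R) : (sum_n_m f 1 0 : R) = 0.
Proof. apply (sum_n_m_zero f). lia. Qed.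

Lemma sum1_S (f : nat -> R) (n : nat) :
  (sum_n_m f 1 (S n) : R) = (sum_n_m f 1 n : R) + f (S n).
Proof. apply (sum_n_Sm f). lia. Qed.

Lemma INR_S_pos (n : nat) : 0 < INR (S n).
Proof. apply lt_0_INR. lia. Qed.

Lemma ln_le_minus_1 (y : R) : 0 < y -> ln y <= y - 1.
Proof.
intros Hy. rewrite <- (ln_exp (y - 1)). apply ln_le; [exact Hy|].
assert (H := exp_ineq1_le (y - 1)). lra.
Qed.

(** Both bounds are [ln y <= y - 1], at [y = n / (n + 1)] and at [y = (n + 1) / n]. *)
Lemma ln_S_bounds (n : nat) : (1 <= n)%nat ->
  / INR (S n) <= ln (INR (S n)) - ln (INR n) <= / INR n.
Proof.
intros Hn. assert (H0 : 0 < INR n) by (apply lt_0_INR; lia).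
assert (H1 := INR_S_pos n). rewrite S_INR in *.
assert (Hi : 0 < / INR n) by now apply Rinv_0_lt_compat.
assert (Hi1 : 0 < / (INR n + 1)) by now apply Rinv_0_lt_compat.
split.
- assert (H := ln_le_minus_1 (INR n / (INR n + 1))).
  unfold Rdiv in H. rewrite ln_mult, ln_Rinv in H by lra.
  replace (INR n * / (INR n + 1) - 1) with (- / (INR n + 1)) in H by (field; lra).
  assert (0 < INR n * / (INR n + 1)) by now apply Rmult_lt_0_compat. lra.
- assert (H := ln_le_minus_1 ((INR n + 1) / INR n)).
  unfold Rdiv in H. rewrite ln_mult, ln_Rinv in H by lra.
  replace ((INR n + 1) * / INR n - 1) with (/ INR n) in H by (field; lra).
  assert (0 < (INR n + 1) * / INR n) by now apply Rmult_lt_0_compat. lra.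
Qed.

Definition harmonic (n : nat) : R := sum_n_m (fun k => / INR k) 1 n.

Lemma harmonic_S (n : nat) : harmonic (S n) = harmonic n + / INR (S n).
Proof. apply sum1_S. Qed.

Lemma harmonic_0 : harmonic 0 = 0.
Proof. apply sum1_0. Qed.

Lemma ln_INR_1 : ln (INR 1) = 0.
Proof. exact ln_1. Qed.

(** [euler_gamma] is defined through the total function [Lim_seq], so convergence has to be
    established: the sequence decreases from index 1 on and is bounded below by 0. *)
Lemma is_lim_seq_euler_gamma :
  is_lim_seq (fun n => harmonic n - ln (INR n)) euler_gamma.
Proof.
apply (Lim_seq_correct' (fun n => harmonic n - ln (INR n))).
(* The shift matters: since [ln 0 = 0] by convention, the unshifted sequence is 0 at index 0 and 1
   at index 1. *)
assert (H : ex_finite_lim_seq (fun n => harmonic (S n) - ln (INR (S n)))).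
{ apply (ex_finite_lim_seq_decr _ 0).
  - intros n. rewrite (harmonic_S (S n)).
    destruct (ln_S_bounds (S n)); [lia|lra].
  - intros n. enough (ln (INR (S n)) <= harmonic n) as Hn.
    { rewrite harmonic_S. assert (H := Rinv_0_lt_compat _ (INR_S_pos n)). lra. }
    induction n as [|n IH].
    + rewrite harmonic_0, ln_INR_1. lra.
    + rewrite harmonic_S. destruct (ln_S_bounds (S n)); [lia|lra]. }
destruct H as [l Hl]. exists l.
now apply (is_lim_seq_incr_1 (fun n => harmonic n - ln (INR n))).
Qed.

(** This is [D n] of the overview. *)
Definition harmonic_rem (n : nat) : R :=
  harmonic n - ln (INR n) - euler_gamma - / (2 * INR n).

(** The Euler-Maclaurin terms of [D n] are [- b_2k / (2k n^(2k))]; adding back those with [k < m]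
    leaves the remainder whose first omitted term has index [m]. *)
Definition bernoulli_rem (B : nat -> R -> R) (m n : nat) : R :=
  harmonic_rem n
  + sum_n_m (fun k => B (2 * k)%nat 0 / (INR (2 * k) * INR n ^ (2 * k))) 1 (m - 1).

Lemma is_lim_seq_inv_INR : is_lim_seq (fun n => / INR n) 0.
Proof.
apply (is_lim_seq_inv INR p_infty); [exact is_lim_seq_INR|discriminate].
Qed.

Lemma is_lim_seq_inv_pow (k : nat) :
  (1 <= k)%nat -> is_lim_seq (fun n => / INR n ^ k) 0.
Proof.
intros Hk. destruct k as [|k]; [lia|]. clear Hk.
induction k as [|k IH].
- apply (is_lim_seq_ext (fun n => / INR n)); [|exact is_lim_seq_inv_INR].
  intros n. now rewrite pow_1.
- apply (is_lim_seq_ext (fun n => / INR n * / INR n ^ S k)).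
  + intros n. change (INR n ^ S (S k)) with (INR n * INR n ^ S k).
    now rewrite Rinv_mult.
  + replace (Finite 0) with (Rbar_mult 0 0) by (simpl; f_equal; ring).
    apply is_lim_seq_mult'; [exact is_lim_seq_inv_INR|exact IH].
Qed.

Lemma is_lim_seq_sum1 (f : nat -> nat -> R) (l : nat -> R) (m : nat) :
  (forall k, (1 <= k <= m)%nat -> is_lim_seq (f k) (l k)) ->
  is_lim_seq (fun n => sum_n_m (fun k => f k n) 1 m) (sum_n_m l 1 m : R).
Proof.
induction m as [|m IH]; intros H.
- rewrite sum1_0. apply (is_lim_seq_ext (fun _ => 0)).
  + intros n. now rewrite sum1_0.
  + apply is_lim_seq_const.
- rewrite sum1_S.
  apply (is_lim_seq_ext (fun n => (sum_n_m (fun k => f k n) 1 m : R) + f (S m) n)).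
  + intros n. now rewrite sum1_S.
  + apply is_lim_seq_plus'; [apply IH|apply H]; intros; [apply H|]; lia.
Qed.

Lemma sum1_const_0 (m : nat) : (sum_n_m (fun _ => 0) 1 m : R) = 0.
Proof. exact (sum_n_m_const_zero 1 m). Qed.

Lemma is_lim_seq_harmonic_rem : is_lim_seq harmonic_rem 0.
Proof.
replace (Finite 0) with (Finite (euler_gamma - euler_gamma - / 2 * 0))
  by (f_equal; ring).
apply (is_lim_seq_ext
  (fun n => harmonic n - ln (INR n) - euler_gamma - / 2 * / INR n)).
- intros n. unfold harmonic_rem. now rewrite Rinv_mult.
- apply is_lim_seq_minus'.
  + apply is_lim_seq_minus'; [exact is_lim_seq_euler_gamma|apply is_lim_seq_const].
  + apply (is_lim_seq_scal_l _ (/ 2) 0), is_lim_seq_inv_INR.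
Qed.

Lemma is_lim_seq_bernoulli_rem (B : nat -> R -> R) (m : nat) :
  is_lim_seq (bernoulli_rem B m) 0.
Proof.
replace (Finite 0) with (Finite (0 + sum_n_m (fun _ => 0) 1 (m - 1)))
  by (now rewrite sum1_const_0, Rplus_0_l).
apply is_lim_seq_plus'; [exact is_lim_seq_harmonic_rem|].
apply (is_lim_seq_sum1
  (fun k n => B (2 * k)%nat 0 / (INR (2 * k) * INR n ^ (2 * k))) (fun _ => 0)).
intros k Hk.
apply (is_lim_seq_ext (fun n => B (2 * k)%nat 0 / INR (2 * k) * / INR n ^ (2 * k))).
- intros n. unfold Rdiv. now rewrite Rinv_mult, Rmult_assoc.
- replace (Finite 0) with (Rbar_mult (B (2 * k)%nat 0 / INR (2 * k)) 0)
    by (simpl; f_equal; ring).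
  apply is_lim_seq_scal_l, is_lim_seq_inv_pow. lia.
Qed.

(** * Integral representation and sign of the remainders *)

Lemma bernoulli_1 (B : nat -> R -> R) (x : R) :
  is_bernoulli B -> B 1%nat x = x - 1 / 2.
Proof.
intros HB.
assert (D : forall y, is_derive (B 1%nat) y 1).
{ intros y. evar_last; [apply (bernoulli_derive B HB O)|].
  destruct HB as [_ [B0 _]]. rewrite B0. simpl. ring. }
assert (E := is_derive_eq_const _ _ D).
assert (H := bernoulli_odd_at_half B 0 HB). simpl in H.
rewrite E in H. rewrite E. lra.
Qed.

Lemma is_RInt_bernoulli_1 (B : nat -> R -> R) (N : R) :
  is_bernoulli B -> 0 < N ->
  is_RInt (fun x => B 1%nat x / (N + x) ^ 2) 0 1
    (ln (N + 1) - ln N - / (2 * N) - / (2 * (N + 1))).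
Proof.
intros HB HN. evar_last.
- apply (is_RInt_ext (fun x => (x - 1 / 2) / (N + x) ^ 2)).
  { intros x _. now rewrite bernoulli_1. }
  (* The antiderivative comes from [x - 1/2 = (N + x) - (N + 1/2)]. *)
  apply (is_RInt_derive_le (fun x => ln (N + x) + (N + 1 / 2) / (N + x))); [lra| |].
  + intros x Hx. auto_derive; [lra|]. field. lra.
  + intros x Hx. apply (ex_derive_continuous (fun x => (x - 1 / 2) / (N + x) ^ 2)).
    auto_derive. apply Rgt_not_eq. nra.
- simpl. rewrite Rplus_0_r. field. lra.
Qed.

(* One integration by parts; [c] is a free integration constant. *)
Lemma is_RInt_bernoulli_step (B : nat -> R -> R) (n : nat) (N c v : R) :
  is_bernoulli B -> 0 < N -> (1 <= n)%nat ->
  is_RInt (fun x => B n x / (N + x) ^ S n) 0 1 v ->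
  is_RInt (fun x => (B (S n) x - c) / (N + x) ^ S (S n)) 0 1
    (v + (B (S n) 0 - c) / INR (S n) * (/ N ^ S n - / (N + 1) ^ S n)).
Proof.
intros HB HN Hn Hv. assert (DB := bernoulli_derive B HB).
assert (HS := INR_S_pos n).
assert (HP : forall x k, 0 <= x -> (N + x) ^ k <> 0)
  by (intros x k Hx; apply pow_nonzero; lra).
(* [f] below is the derivative of [F], as [B_(n+1)' = (n+1) B_n]. The boundary values of [F] share
   the numerator [B_(n+1)(0) - c], because [B_(n+1)] agrees at 0 and 1 for [n >= 1]. *)
set (F := fun x => (B (S n) x - c) / (INR (S n) * (N + x) ^ S n)).
set (f := fun x => B n x / (N + x) ^ S n - (B (S n) x - c) / (N + x) ^ S (S n)).
assert (HF : is_RInt f 0 1 (F 1 - F 0)).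
{ apply is_RInt_derive_le; [lra| |].
  - intros x [Hx _].
    assert (E : Derive (fun t => B (S n) t) x = INR (S n) * B n x)
      by apply is_derive_unique, DB.
    unfold F. auto_derive.
    + repeat split; [eexists; apply DB|].
      change (match n with O => 1 | S _ => INR n + 1 end) with (INR (S n)).
      apply Rmult_integral_contrapositive_currified; [lra|apply (HP x (S n)), Hx].
    + rewrite E. unfold f.
      change (match n with O => 1 | S _ => INR n + 1 end) with (INR (S n)).
      change (Init.Nat.pred (S n)) with n.
      cbn [pow]. field. specialize (HP x n Hx). repeat split; lra.
  - intros x [Hx _]. unfold f.
    assert (E : forall k, ex_derive (B k) x).
    { intros k. eexists. apply is_polynomial_Derive, HB. }
    apply (ex_derive_continuous
      (fun x => B n x / (N + x) ^ S n - (B (S n) x - c) / (N + x) ^ S (S n))).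
    auto_derive. repeat split; try apply E.
    + apply (HP x (S n) Hx).
    + apply (HP x (S (S n)) Hx). }
assert (H := is_RInt_minus _ _ _ _ _ _ Hv HF). evar_last.
- eapply is_RInt_ext; [|exact H].
  intros x _. unfold minus, plus, opp, f; simpl. ring.
- change (v - (F 1 - F 0)
    = v + (B (S n) 0 - c) / INR (S n) * (/ N ^ S n - / (N + 1) ^ S n)).
  unfold F.
  rewrite bernoulli_at_1 by (auto; lia). rewrite Rplus_0_r.
  assert (H0 := HP 0 n (Rle_refl 0)). assert (H1 := HP 1 n Rle_0_1).
  rewrite Rplus_0_r in H0. cbn [pow].
  field. repeat split; lra.
Qed.

(** Two integrations by parts with [c = 0] lead from degree [2m+1] to [2m+3]. The first boundary
    term is the difference at [n] and [n+1] of the new term of [bernoulli_rem]; the second is zero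
    since [b_(2m+3) = 0]. *)
Lemma is_RInt_bernoulli_rem (B : nat -> R -> R) (m n : nat) :
  is_bernoulli B -> (1 <= n)%nat ->
  is_RInt (fun x => B (2 * m + 1)%nat x / (INR n + x) ^ S (2 * m + 1)) 0 1
    (bernoulli_rem B (S m) n - bernoulli_rem B (S m) (S n)).
Proof.
intros HB Hn. assert (HN : 0 < INR n) by (apply lt_0_INR; lia).
induction m as [|m IH].
- evar_last; [apply (is_RInt_bernoulli_1 B (INR n) HB HN)|].
  unfold bernoulli_rem, harmonic_rem. simpl Nat.sub. rewrite !sum1_0.
  rewrite harmonic_S. rewrite !S_INR. field. lra.
- apply (is_RInt_bernoulli_step _ _ _ 0) in IH; [|auto|auto|lia].
  apply (is_RInt_ext _ (fun x => B (S (2 * m + 1)) x / (INR n + x) ^ S (S (2 * m + 1))))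
    in IH; [|intros x _; now rewrite Rminus_0_r].
  apply (is_RInt_bernoulli_step _ _ _ 0) in IH; [|auto|auto|lia].
  replace (S (S (2 * m + 1))) with (2 * S m + 1)%nat in IH by lia.
  rewrite (bernoulli_odd_at_0 B (S m)) in IH by (auto; lia).
  evar_last.
  + eapply is_RInt_ext; [|exact IH]. intros x _. cbv beta. now rewrite Rminus_0_r.
  + unfold bernoulli_rem. replace (S (S m) - 1)%nat with (S m) by lia.
    replace (S m - 1)%nat with m by lia. rewrite !sum1_S.
    replace (S (2 * m + 1)) with (2 * S m)%nat by lia.
    rewrite <- S_INR, !Rminus_0_r, Rdiv_0_l, Rmult_0_l, Rplus_0_r.
    assert (H0 : INR n ^ (2 * S m) <> 0) by (apply pow_nonzero; lra).
    assert (H1 : INR (S n) ^ (2 * S m) <> 0)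
      by (apply pow_nonzero, not_0_INR; lia).
    assert (H2 : INR (2 * S m) <> 0) by (apply not_0_INR; lia).
    match goal with |- @eq _ ?a ?b => change (@eq R a b) end.
    set (s := sum_n_m _ 1 m : R). set (s' := sum_n_m _ 1 m : R).
    field. auto.
Qed.

(** A further integration by parts with [c = b_(2m+2)] has no boundary term, and its integrand has
    constant sign by [bernoulli_even_sign]. *)
Lemma bernoulli_rem_decr (B : nat -> R -> R) (m n : nat) :
  is_bernoulli B -> (1 <= n)%nat ->
  0 < (-1) ^ S m * (bernoulli_rem B (S m) n - bernoulli_rem B (S m) (S n)).
Proof.
intros HB Hn. assert (HN : 0 < INR n) by (apply lt_0_INR; lia).
assert (H := is_RInt_bernoulli_rem B m n HB Hn).
apply (is_RInt_bernoulli_step _ _ _ (B (S (2 * m + 1)) 0)) in H; [|auto|auto|lia].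
replace (S (2 * m + 1)) with (2 * S m)%nat in H by lia.
set (b := B (2 * S m)%nat 0) in *.
apply (is_RInt_scal _ _ _ ((-1) ^ S m)) in H.
apply is_RInt_gt_0 in H; [|lra| |].
- unfold scal in H; simpl in H; unfold mult in H; simpl in H. simpl. lra.
- intros x Hx. unfold scal; simpl; unfold mult; simpl.
  assert (Hb := bernoulli_even_sign B (S m) x HB ltac:(lia) Hx).
  assert (Hp := pow_lt (INR n + x) (S (2 * S m)) ltac:(lra)).
  apply Rinv_0_lt_compat in Hp.
  assert (Hq := Rmult_lt_0_compat _ _ Hb Hp). simpl in Hq. unfold b. simpl.
  unfold Rdiv. lra.
- intros x Hx.
  assert (E : ex_derive (B (2 * S m)%nat) x).
  { eexists. apply is_polynomial_Derive, HB. }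
  apply (ex_derive_continuous
    (fun x => (-1) ^ S m * ((B (2 * S m)%nat x - b) / (INR n + x) ^ S (2 * S m)))).
  auto_derive. split; [exact E|]. split; [|exact I].
  apply (pow_nonzero (INR n + x) (S (2 * S m))). lra.
Qed.

Lemma decr_lim_0_pos (u : nat -> R) :
  (forall n, (1 <= n)%nat -> u (S n) < u n) -> is_lim_seq u 0 ->
  forall n, (1 <= n)%nat -> 0 < u n.
Proof.
intros Hd Hl n Hn.
assert (H : 0 <= u (S n)).
{ apply (is_lim_seq_incr_1 u) in Hl.
  assert (H := is_lim_seq_decr_compare (fun n => u (S n)) 0 Hl).
  apply H. intros k. apply Rlt_le, Hd. lia. }
specialize (Hd n Hn). lra.
Qed.

(** For fixed [m], the signed remainder strictly decreases to 0 in [n], so it is positive. *)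
Lemma bernoulli_rem_sign (B : nat -> R -> R) (m n : nat) :
  is_bernoulli B -> (1 <= m)%nat -> (1 <= n)%nat ->
  0 < (-1) ^ m * bernoulli_rem B m n.
Proof.
intros HB Hm. destruct m as [|m]; [lia|].
apply (decr_lim_0_pos (fun n => (-1) ^ S m * bernoulli_rem B (S m) n)).
- intros k Hk. assert (H := bernoulli_rem_decr B m k HB Hk). lra.
- replace (Finite 0) with (Rbar_mult ((-1) ^ S m) 0) by (simpl; f_equal; ring).
  apply is_lim_seq_scal_l, is_lim_seq_bernoulli_rem.
Qed.

Lemma Rabs_bernoulli_number (B : nat -> R -> R) (m : nat) :
  is_bernoulli B -> (1 <= m)%nat ->
  Rabs (bernoulli_number B (2 * m)) = (-1) ^ S m * B (2 * m)%nat 0.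
Proof.
intros HB Hm. unfold bernoulli_number.
rewrite <- (Rabs_pos_eq _ (Rlt_le _ _ (bernoulli_number_sign B m HB Hm))).
now rewrite Rabs_mult, pow_1_abs, Rmult_1_l.
Qed.

(* The upper bound is the sign of the next remainder. *)
Lemma bernoulli_rem_bound (B : nat -> R -> R) (m n : nat) :
  is_bernoulli B -> (1 <= m)%nat -> (1 <= n)%nat ->
  (-1) ^ m * bernoulli_rem B m n
  < Rabs (bernoulli_number B (2 * m)) / (INR (2 * m) * INR n ^ (2 * m)).
Proof.
intros HB Hm Hn. rewrite Rabs_bernoulli_number by auto.
assert (H := bernoulli_rem_sign B (S m) n HB ltac:(lia) Hn).
unfold bernoulli_rem in *. destruct m as [|m]; [lia|].
replace (S (S m) - 1)%nat with (S m) in H by lia.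
replace (S m - 1)%nat with m by lia. rewrite sum1_S in H.
change ((-1) ^ S (S m)) with (-1 * (-1) ^ S m) in *.
unfold Rdiv in *. lra.
Qed.

(** * Partial fractions of the cotangent and Wallis' product *)

(** At [x = 0] these are Wallis' integrals. For even [n], the recursion started from
    [sin (PI x) / (2 x)] reproduces the factors of Euler's product for the sine. *)
Definition cos_int (n : nat) (x : R) : R :=
  RInt (fun t => cos (2 * x * t) * cos t ^ n) 0 (PI / 2).

(* [- 2 * tsin_int n x] is the derivative of [cos_int n] at [x]; its recursion is
   the derivative of that of [cos_int], so that [tsin_int_rec] needs no
   differentiation under the integral sign. *)
Definition tsin_int (n : nat) (x : R) : R :=
  RInt (fun t => t * sin (2 * x * t) * cos t ^ n) 0 (PI / 2).

Lemma is_RInt_cos_int (n : nat) (x : R) :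
  is_RInt (fun t => cos (2 * x * t) * cos t ^ n) 0 (PI / 2) (cos_int n x).
Proof.
apply (RInt_correct (V := R_CompleteNormedModule)),
  (ex_RInt_continuous (V := R_CompleteNormedModule)).
intros t _.
apply (ex_derive_continuous (fun t => cos (2 * x * t) * cos t ^ n)).
auto_derive. exact I.
Qed.

Lemma is_RInt_tsin_int (n : nat) (x : R) :
  is_RInt (fun t => t * sin (2 * x * t) * cos t ^ n) 0 (PI / 2) (tsin_int n x).
Proof.
apply (RInt_correct (V := R_CompleteNormedModule)),
  (ex_RInt_continuous (V := R_CompleteNormedModule)).
intros t _.
apply (ex_derive_continuous (fun t => t * sin (2 * x * t) * cos t ^ n)).
auto_derive. exact I.
Qed.

Lemma is_RInt_value (F f : R -> R) (a b u : R) :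
  a <= b -> is_RInt f a b u ->
  (forall x, a <= x <= b -> is_derive F x (f x)) ->
  (forall x, a <= x <= b -> continuous f x) ->
  u = F b - F a.
Proof.
intros Hab Hu HF Hf.
exact (is_RInt_eq _ _ _ _ _ Hu (is_RInt_derive_le F f a b Hab HF Hf)).
Qed.

Lemma is_RInt_lin2 (f g : R -> R) (a b u v c d : R) :
  is_RInt f a b u -> is_RInt g a b v ->
  is_RInt (fun t => c * f t + d * g t) a b (c * u + d * v).
Proof.
intros Hf Hg.
exact (is_RInt_plus _ _ _ _ _ _
  (is_RInt_scal _ _ _ c _ Hf) (is_RInt_scal _ _ _ d _ Hg)).
Qed.

Lemma PI2_pos : 0 < PI / 2.
Proof. assert (H := PI_RGT_0). lra. Qed.

Lemma INR_SS (n : nat) : INR (S (S n)) = INR n + 2.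
Proof. rewrite !S_INR. ring. Qed.

Lemma sin_sqr (t : R) : sin t ^ 2 = 1 - cos t ^ 2.
Proof. assert (H := sin2_cos2 t). unfold Rsqr in H. simpl. lra. Qed.

(** The combination of integrands is the derivative of [F], the boundary term of two integrations by
    parts, which vanishes at 0 and at [PI / 2]. *)
Lemma cos_int_rec (n : nat) (x : R) :
  (INR (S (S n)) ^ 2 - 4 * x ^ 2) * cos_int (S (S n)) x
  = INR (S (S n)) * INR (S n) * cos_int n x.
Proof.
assert (H := is_RInt_lin2 _ _ _ _ _ _
  (INR (S (S n)) ^ 2 - 4 * x ^ 2) (- (INR (S (S n)) * INR (S n)))
  (is_RInt_cos_int (S (S n)) x) (is_RInt_cos_int n x)).
set (F := fun t => INR (S (S n)) * cos (2 * x * t) * cos t ^ S n * sin t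
                   - 2 * x * sin (2 * x * t) * cos t ^ S (S n)).
assert (E := is_RInt_value F _ _ _ _ (Rlt_le _ _ PI2_pos) H).
lapply E; clear E; [intros E; lapply E; clear E; [intros E|]|].
- unfold F in E. rewrite cos_PI2, sin_0 in E.
  rewrite !Rmult_0_r, sin_0 in E. rewrite !(pow_i) in E by lia. lra.
- intros t _. apply (ex_derive_continuous (fun t =>
    (INR (S (S n)) ^ 2 - 4 * x ^ 2) * (cos (2 * x * t) * cos t ^ S (S n))
    + - (INR (S (S n)) * INR (S n)) * (cos (2 * x * t) * cos t ^ n))).
  auto_derive. exact I.
- intros t _. unfold F. auto_derive; [exact I|].
  change (Init.Nat.pred (S (S n))) with (S n). change (Init.Nat.pred (S n)) with n.
  assert (Hs := sin_sqr t).
  change (match n with O => 1 | S _ => INR n + 1 end) with (INR (S n)).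
  rewrite INR_SS, S_INR. cbn [pow]. ring [Hs].
Qed.

Lemma tsin_int_rec (n : nat) (x : R) :
  (INR (S (S n)) ^ 2 - 4 * x ^ 2) * tsin_int (S (S n)) x
  + 4 * x * cos_int (S (S n)) x
  = INR (S (S n)) * INR (S n) * tsin_int n x.
Proof.
assert (H := is_RInt_lin2 _ _ _ _ _ _ 1 (4 * x)
  (is_RInt_lin2 _ _ _ _ _ _
    (INR (S (S n)) ^ 2 - 4 * x ^ 2) (- (INR (S (S n)) * INR (S n)))
    (is_RInt_tsin_int (S (S n)) x) (is_RInt_tsin_int n x))
  (is_RInt_cos_int (S (S n)) x)).
(* This is [-1/2] times the derivative in [x] of the [F] used for [cos_int_rec]. *)
set (F := fun t => INR (S (S n)) * t * sin (2 * x * t) * cos t ^ S n * sin t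
                   + sin (2 * x * t) * cos t ^ S (S n)
                   + 2 * x * t * cos (2 * x * t) * cos t ^ S (S n)).
assert (E := is_RInt_value F _ _ _ _ (Rlt_le _ _ PI2_pos) H).
lapply E; clear E; [intros E; lapply E; clear E; [intros E|]|].
- unfold F in E. rewrite cos_PI2, sin_0 in E.
  rewrite !Rmult_0_r, sin_0 in E. rewrite !(pow_i) in E by lia. lra.
- intros t _. apply (ex_derive_continuous (fun t =>
    1 * ((INR (S (S n)) ^ 2 - 4 * x ^ 2) * (t * sin (2 * x * t) * cos t ^ S (S n))
    + - (INR (S (S n)) * INR (S n)) * (t * sin (2 * x * t) * cos t ^ n))
    + 4 * x * (cos (2 * x * t) * cos t ^ S (S n)))).
  auto_derive. exact I.
- intros t _. unfold F. auto_derive; [exact I|].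
  change (Init.Nat.pred (S (S n))) with (S n). change (Init.Nat.pred (S n)) with n.
  assert (Hs := sin_sqr t).
  change (match n with O => 1 | S _ => INR n + 1 end) with (INR (S n)).
  rewrite INR_SS, S_INR. cbn [pow]. ring [Hs].
Qed.

Lemma cos_int_0 (x : R) : x <> 0 -> cos_int 0 x = sin (PI * x) / (2 * x).
Proof.
intros Hx. apply (is_RInt_eq _ _ _ _ _ (is_RInt_cos_int 0 x)). evar_last.
- apply (is_RInt_derive_le (fun t => sin (2 * x * t) / (2 * x))); [apply Rlt_le, PI2_pos| |].
  + intros t _. auto_derive; [lra|]. simpl. field. exact Hx.
  + intros t _. apply (ex_derive_continuous (fun t => cos (2 * x * t) * cos t ^ 0)).
    auto_derive. exact I.
- simpl. replace (2 * x * (PI / 2)) with (PI * x) by field.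
  rewrite !Rmult_0_r, sin_0. field. exact Hx.
Qed.

Lemma tsin_int_0 (x : R) : x <> 0 ->
  tsin_int 0 x = sin (PI * x) / (4 * x ^ 2) - PI * cos (PI * x) / (4 * x).
Proof.
intros Hx. apply (is_RInt_eq _ _ _ _ _ (is_RInt_tsin_int 0 x)). evar_last.
- apply (is_RInt_derive_le
    (fun t => sin (2 * x * t) / (4 * x ^ 2) - t * cos (2 * x * t) / (2 * x)));
    [apply Rlt_le, PI2_pos| |].
  + intros t _. auto_derive; [exact I|]. simpl. field. exact Hx.
  + intros t _. apply (ex_derive_continuous (fun t => t * sin (2 * x * t) * cos t ^ 0)).
    auto_derive. exact I.
- simpl. replace (2 * x * (PI / 2)) with (PI * x) by field.
  rewrite !Rmult_0_r, sin_0. field. exact Hx.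
Qed.

Lemma Rmult_cos_le_sin (t : R) : 0 <= t <= PI / 2 -> t * cos t <= sin t.
Proof.
intros Ht. destruct (Req_dec t 0) as [->|Ht0].
{ rewrite sin_0. lra. }
assert (HPI := PI_RGT_0).
destruct (MVT_is_derive (fun t => sin t - t * cos t) (fun t => t * sin t) 0 t)
  as [c [Hc Hc']]; [lra| |].
{ intros c _. auto_derive; [exact I|ring]. }
rewrite sin_0 in Hc.
assert (0 < sin c) by (apply sin_gt_0; lra).
assert (0 < c * sin c * (t - 0)) by (repeat apply Rmult_lt_0_compat; lra). lra.
Qed.

(** The inequality [t cos t <= sin t] absorbs the factor [t] and one cosine; the integral of the
    remaining [sin t cos(t)^n] is [1 / (n+1)]. *)
Lemma Rabs_tsin_int_le (n : nat) (x : R) : Rabs (tsin_int (S n) x) <= / INR (S n).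
Proof.
assert (HPI := PI_RGT_0).
apply (norm_RInt_le (fun t => t * sin (2 * x * t) * cos t ^ S n)
  (fun t => sin t * cos t ^ n) 0 (PI / 2) (tsin_int (S n) x) (/ INR (S n))).
- lra.
- intros t Ht. change (Rabs (t * sin (2 * x * t) * cos t ^ S n) <= sin t * cos t ^ n).
  assert (Hc : 0 <= cos t) by (apply cos_ge_0; lra).
  rewrite !Rabs_mult, (Rabs_pos_eq t), (Rabs_pos_eq (cos t ^ S n))
    by (try apply pow_le; lra).
  assert (Hs : Rabs (sin (2 * x * t)) <= 1) by (apply Rabs_le, SIN_bound).
  apply Rle_trans with (t * 1 * cos t ^ S n).
  + apply Rmult_le_compat_r; [now apply pow_le|].
    apply Rmult_le_compat_l; lra.
  + simpl. replace (t * 1 * (cos t * cos t ^ n)) with (t * cos t * cos t ^ n) by ring.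
    apply Rmult_le_compat_r; [now apply pow_le|].
    now apply Rmult_cos_le_sin.
- apply is_RInt_tsin_int.
- evar_last.
  + apply (is_RInt_derive_le (fun t => - cos t ^ S n / INR (S n))); [lra| |].
    * intros t _. auto_derive; [exact I|].
      change (match n with O => 1 | S _ => INR n + 1 end) with (INR (S n)).
      change (Init.Nat.pred (S n)) with n. field. apply not_0_INR; lia.
    * intros t _. apply (ex_derive_continuous (fun t => sin t * cos t ^ n)).
      auto_derive. exact I.
  + cbv beta. rewrite cos_PI2, cos_0, pow1, pow_i by lia.
    field. apply not_0_INR; lia.
Qed.

Lemma cos_int_even_rec (j : nat) (x : R) :
  (INR (S j) ^ 2 - x ^ 2) * cos_int (2 * S j) x
  = INR (S j) * (INR (S j) - / 2) * cos_int (2 * j) x.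
Proof.
assert (H := cos_int_rec (2 * j) x).
replace (S (S (2 * j))) with (2 * S j)%nat in H by lia.
rewrite (S_INR (2 * j)), !mult_INR in H. change (INR 2) with 2 in H.
rewrite S_INR in *. lra.
Qed.

Lemma cos_int_even_pos (j : nat) (x : R) : 0 < x < 1 -> 0 < cos_int (2 * j) x.
Proof.
intros Hx. assert (HPI := PI_RGT_0). induction j as [|j IH].
- simpl. rewrite cos_int_0 by lra. apply Rdiv_lt_0_compat; [|lra].
  apply sin_gt_0; [apply Rmult_lt_0_compat; lra|].
  rewrite <- (Rmult_1_r PI) at 2. apply Rmult_lt_compat_l; lra.
- assert (H := cos_int_even_rec j x).
  assert (Hj : 1 <= INR (S j)) by (rewrite S_INR; assert (H0 := pos_INR j); lra).
  assert (Hp : 0 < INR (S j) * (INR (S j) - / 2) * cos_int (2 * j) x)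
    by (repeat apply Rmult_lt_0_compat; lra).
  assert (Hq : 0 < INR (S j) ^ 2 - x ^ 2) by nra.
  rewrite <- H in Hp. apply Rnot_le_lt. intros Hn.
  assert (0 <= (INR (S j) ^ 2 - x ^ 2) * - cos_int (2 * S j) x)
    by (apply Rmult_le_pos; lra). lra.
Qed.

(** The left side is minus the logarithmic derivative of [cos_int (2 * j)]. Dividing the recursion
    of [tsin_int] by that of [cos_int] shows that each step contributes one partial fraction; the
    cotangent comes from the closed forms at [j = 0]. *)
Lemma tsin_cos_ratio (j : nat) (x : R) : 0 < x < 1 ->
  2 * (tsin_int (2 * j) x / cos_int (2 * j) x)
  = / x + sum_n_m (fun k => 2 * x / (x ^ 2 - INR k ^ 2)) 1 j
    - PI * cot (PI * x).
Proof.
intros Hx. assert (HPI := PI_RGT_0).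
induction j as [|j IH].
- rewrite sum1_0. simpl. unfold cot.
  assert (Hs : 0 < sin (PI * x)).
  { apply sin_gt_0; [apply Rmult_lt_0_compat; lra|].
    rewrite <- (Rmult_1_r PI) at 2. apply Rmult_lt_compat_l; lra. }
  rewrite cos_int_0, tsin_int_0 by lra. field. lra.
- rewrite sum1_S.
  assert (Hc := cos_int_even_pos j x Hx).
  assert (Hc' := cos_int_even_pos (S j) x Hx).
  assert (R1 := cos_int_even_rec j x).
  assert (R2 := tsin_int_rec (2 * j) x).
  replace (S (S (2 * j))) with (2 * S j)%nat in R2 by lia.
  rewrite (S_INR (2 * j)), !mult_INR in R2. change (INR 2) with 2 in R2.
  assert (Hj : 1 <= INR (S j)) by (rewrite S_INR; assert (H0 := pos_INR j); lra).
  assert (Hq : 0 < INR (S j) ^ 2 - x ^ 2) by nra.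
  assert (Hr : 0 < INR (S j) * (INR (S j) - / 2)) by (apply Rmult_lt_0_compat; lra).
  replace (INR j) with (INR (S j) - 1) in R2 by (rewrite S_INR; ring).
  set (c := cos_int (2 * S j) x) in *. set (s := tsin_int (2 * S j) x) in *.
  set (c' := cos_int (2 * j) x) in *. set (s' := tsin_int (2 * j) x) in *.
  set (J := INR (S j)) in *.
  assert (Es : s' / c' = s / c + x / (J ^ 2 - x ^ 2)).
  { assert (Ec : c' = (J ^ 2 - x ^ 2) * c / (J * (J - / 2)))
      by (rewrite R1; field; lra).
    assert (Es' : s' = ((J ^ 2 - x ^ 2) * s + x * c) / (J * (J - / 2))).
    { apply (Rmult_eq_reg_r (J * (J - / 2))); [|lra].
      unfold Rdiv. rewrite Rmult_assoc, Rinv_l by lra. lra. }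
    rewrite Ec, Es'. field. repeat split; try lra; nra. }
  replace (2 * x / (x ^ 2 - J ^ 2)) with (- 2 * (x / (J ^ 2 - x ^ 2)))
    by (field; lra).
  lra.
Qed.

(** For [n >= 1] the quantity [n * cos_int (2 * n) x ^ 2] is nondecreasing, because
    [(J - 1/2)^2 >= J (J - 1)]. Hence [cos_int (2 * n) x] decays no faster than a multiple of
    [n^(-1/2)]. *)
Lemma cos_int_even_lower (j : nat) (x : R) : 0 < x < 1 ->
  cos_int 2 x ^ 2 <= INR (S j) * cos_int (2 * S j) x ^ 2.
Proof.
intros Hx. induction j as [|j IH].
- simpl. lra.
- apply (Rle_trans _ _ _ IH).
  assert (Hc := cos_int_even_pos (S j) x Hx).
  assert (Hc' := cos_int_even_pos (S (S j)) x Hx).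
  assert (R1 := cos_int_even_rec (S j) x).
  set (c := cos_int (2 * S j) x) in *. set (c' := cos_int (2 * S (S j)) x) in *.
  replace (INR (S j)) with (INR (S (S j)) - 1) by (rewrite (S_INR (S j)); ring).
  assert (Hj : 2 <= INR (S (S j))) by (rewrite INR_SS; assert (H0 := pos_INR j); lra).
  set (J := INR (S (S j))) in *.
  assert (H1 : (J - / 2) * c <= J * c').
  { apply (Rmult_le_reg_l J); [lra|].
    assert (0 < x ^ 2 * c') by (apply Rmult_lt_0_compat; [apply pow_lt|]; lra).
    lra. }
  assert (H2 : ((J - / 2) * c) ^ 2 <= (J * c') ^ 2).
  { apply pow_incr. split; [apply Rmult_le_pos; lra|exact H1]. }
  apply (Rmult_le_reg_l J); [lra|].
  apply Rle_trans with (((J - / 2) * c) ^ 2); [|lra].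
  assert (H3 := pow2_ge_0 c).
  replace (J * ((J - 1) * c ^ 2)) with (((J - / 2) * c) ^ 2 - c ^ 2 / 4) by field. lra.
Qed.

(** The numerator is at most [1 / (2j)] and the denominator at least a multiple of [j^(-1/2)], so
    the square of the ratio is at most [C / j]. *)
Lemma is_lim_seq_tsin_cos_ratio (x : R) : 0 < x < 1 ->
  is_lim_seq (fun j => tsin_int (2 * j) x / cos_int (2 * j) x) 0.
Proof.
intros Hx.
assert (Hc1 := cos_int_even_pos 1 x Hx). change (2 * 1)%nat with 2%nat in Hc1.
set (C := / (4 * cos_int 2 x ^ 2)).
apply is_lim_seq_incr_1, is_lim_seq_abs_0.
apply (is_lim_seq_le_le (fun _ => 0) _ (fun j => sqrt (C * / INR (S j)))).
- intros j. split; [apply Rabs_pos|].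
  rewrite <- sqrt_Rsqr_abs. apply sqrt_le_1_alt.
  assert (H1 := Rabs_tsin_int_le (2 * j + 1) x).
  replace (S (2 * j + 1)) with (2 * S j)%nat in H1 by lia.
  assert (H2 := cos_int_even_lower j x Hx).
  assert (H3 := cos_int_even_pos (S j) x Hx).
  assert (HJ := INR_S_pos j).
  rewrite mult_INR in H1. change (INR 2) with 2 in H1.
  set (s := tsin_int (2 * S j) x) in *. set (c := cos_int (2 * S j) x) in *.
  set (J := INR (S j)) in *.
  assert (H4 : s ^ 2 <= (/ (2 * J)) ^ 2).
  { rewrite <- (pow2_abs s). apply pow_incr. split; [apply Rabs_pos|exact H1]. }
  unfold Rsqr, C.
  assert (Hc2 : 0 < cos_int 2 x ^ 2) by now apply pow_lt.
  assert (Hc3 : 0 < c ^ 2) by now apply pow_lt.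
  replace (s / c * (s / c)) with (s ^ 2 / c ^ 2) by (field; lra).
  apply Rle_trans with ((/ (2 * J)) ^ 2 / c ^ 2).
  { apply Rmult_le_compat_r; [now apply Rlt_le, Rinv_0_lt_compat|exact H4]. }
  replace ((/ (2 * J)) ^ 2 / c ^ 2) with (/ (4 * J) * / (J * c ^ 2)) by (field; lra).
  replace (/ (4 * cos_int 2 x ^ 2) * / J) with (/ (4 * J) * / (cos_int 2 x ^ 2))
    by (field; lra).
  apply Rmult_le_compat_l; [apply Rlt_le, Rinv_0_lt_compat; lra|].
  now apply Rinv_le_contravar.
- apply is_lim_seq_const.
- rewrite <- sqrt_0. apply is_lim_seq_continuous; [apply continuity_pt_sqrt; lra|].
  replace (Finite 0) with (Rbar_mult C 0) by (simpl; f_equal; ring).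
  apply is_lim_seq_scal_l. apply (is_lim_seq_incr_1 (fun n => / INR n)).
  exact is_lim_seq_inv_INR.
Qed.

Lemma cot_partial_fractions (x : R) : 0 < x < 1 ->
  is_lim_seq
    (fun M => / x + sum_n_m (fun k => 2 * x / (x ^ 2 - INR k ^ 2)) 1 M)
    (PI * cot (PI * x)).
Proof.
intros Hx.
replace (Finite (PI * cot (PI * x)))
  with (Finite (2 * 0 + PI * cot (PI * x))) by (f_equal; ring).
apply (is_lim_seq_ext
  (fun j => 2 * (tsin_int (2 * j) x / cos_int (2 * j) x) + PI * cot (PI * x))).
- intros j. rewrite tsin_cos_ratio by exact Hx.
  match goal with |- @eq _ ?a ?b => change (@eq R a b) end. ring.
- apply is_lim_seq_plus'; [|apply is_lim_seq_const].
  apply (is_lim_seq_scal_l _ 2 0), is_lim_seq_tsin_cos_ratio, Hx.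
Qed.

(** * Wallis' integrals and their asymptotics *)

Lemma wallis_rec (n : nat) :
  INR (S (S n)) * cos_int (S (S n)) 0 = INR (S n) * cos_int n 0.
Proof.
assert (H := cos_int_rec n 0). assert (HS := INR_S_pos (S n)).
apply (Rmult_eq_reg_l (INR (S (S n)))); lra.
Qed.

Lemma wallis_0 : cos_int 0 0 = PI / 2.
Proof.
apply (is_RInt_eq _ _ _ _ _ (is_RInt_cos_int 0 0)). evar_last.
- apply (is_RInt_ext (fun _ => 1)).
  + intros t _. rewrite Rmult_0_r, Rmult_0_l, cos_0. simpl. ring.
  + apply is_RInt_const.
- unfold scal; simpl; unfold mult; simpl. ring.
Qed.

Lemma wallis_1 : cos_int 1 0 = 1.
Proof.
apply (is_RInt_eq _ _ _ _ _ (is_RInt_cos_int 1 0)). evar_last.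
- apply (is_RInt_ext cos).
  + intros t _. rewrite Rmult_0_r, Rmult_0_l, cos_0. simpl. ring.
  + apply (is_RInt_derive_le sin cos); [apply Rlt_le, PI2_pos| |].
    * intros t _. apply is_derive_sin.
    * intros t _. apply continuous_cos.
- rewrite sin_PI2, sin_0. ring.
Qed.

Lemma wallis_pos (n : nat) : 0 < cos_int n 0.
Proof.
enough (0 < cos_int n 0 /\ 0 < cos_int (S n) 0) by tauto.
induction n as [|n [IH1 IH2]].
- rewrite wallis_0, wallis_1. split; [exact PI2_pos|lra].
- split; [exact IH2|].
  assert (H := wallis_rec n). assert (H1 := INR_S_pos n). assert (H2 := INR_S_pos (S n)).
  replace (cos_int (S (S n)) 0) with (INR (S n) * cos_int n 0 / INR (S (S n)))
    by (rewrite <- H; field; lra).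
  apply Rdiv_lt_0_compat; [now apply Rmult_lt_0_compat|exact H2].
Qed.

Lemma wallis_decr (n : nat) : cos_int (S n) 0 <= cos_int n 0.
Proof.
apply (is_RInt_le _ _ _ _ _ _ (Rlt_le _ _ PI2_pos)
  (is_RInt_cos_int (S n) 0) (is_RInt_cos_int n 0)).
intros t Ht. rewrite Rmult_0_r, Rmult_0_l, cos_0, !Rmult_1_l.
assert (0 <= cos t) by (apply cos_ge_0; lra).
rewrite <- (Rmult_1_l (cos t ^ n)).
apply Rmult_le_compat_r; [now apply pow_le|]. apply COS_bound.
Qed.

(** The recursion makes the left side independent of [n]. *)
Lemma wallis_product (n : nat) :
  INR (S n) * cos_int n 0 * cos_int (S n) 0 = PI / 2.
Proof.
induction n as [|n IH].
- rewrite wallis_0, wallis_1. simpl. ring.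
- rewrite <- IH. assert (H := wallis_rec n).
  rewrite <- H. ring.
Qed.

(** Monotonicity of the integrals in the exponent places [cos_int (2 * n) 0 ^ 2] between two
    consecutive products given by [wallis_product]. *)
Lemma is_lim_seq_wallis :
  is_lim_seq (fun n => INR n * cos_int (2 * n) 0 ^ 2) (PI / 4).
Proof.
apply is_lim_seq_incr_1.
apply (is_lim_seq_le_le
  (fun n => PI / 4 - PI / 8 * / INR (S n)) _ (fun _ => PI / 4)).
- intros n.
  assert (P1 := wallis_product (2 * S n)).
  assert (P2 := wallis_product (2 * n + 1)).
  replace (S (2 * n + 1)) with (2 * S n)%nat in P2 by lia.
  assert (L1 := wallis_decr (2 * S n)). assert (L2 := wallis_decr (2 * n + 1)).
  replace (S (2 * n + 1)) with (2 * S n)%nat in L2 by lia.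
  assert (H := wallis_pos (2 * S n)). assert (HPI := PI_RGT_0).
  rewrite (S_INR (2 * S n)) in P1. rewrite mult_INR in P1, P2.
  change (INR 2) with 2 in P1, P2. assert (HJ := INR_S_pos n).
  set (c := cos_int (2 * S n) 0) in *. set (J := INR (S n)) in *.
  assert (Q1 : PI / 2 <= (2 * J + 1) * c ^ 2).
  { rewrite <- P1. replace ((2 * J + 1) * c ^ 2) with ((2 * J + 1) * c * c) by ring.
    apply Rmult_le_compat_l; [apply Rmult_le_pos; lra|exact L1]. }
  assert (Q2 : 2 * J * c ^ 2 <= PI / 2).
  { rewrite <- P2. replace (2 * J * c ^ 2) with (2 * J * c * c) by ring.
    apply Rmult_le_compat_r; [lra|]. apply Rmult_le_compat_l; lra. }
  split; [|lra].
  assert (Q3 : c ^ 2 <= PI / 4 * / J).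
  { apply (Rmult_le_reg_l J); [exact HJ|].
    replace (J * (PI / 4 * / J)) with (PI / 4) by (field; lra). lra. }
  lra.
- replace (Finite (PI / 4)) with (Finite (PI / 4 - PI / 8 * 0)) by (f_equal; ring).
  apply is_lim_seq_minus'; [apply is_lim_seq_const|].
  apply (is_lim_seq_scal_l _ (PI / 8) 0).
  apply (is_lim_seq_incr_1 (fun n => / INR n)), is_lim_seq_inv_INR.
- apply is_lim_seq_const.
Qed.

(** The closed form of Wallis' integral by the central binomial coefficient; it links the Wallis
    limit to factorials. *)
Lemma wallis_fact (n : nat) :
  cos_int (2 * n) 0 * (4 ^ n * INR (fact n) ^ 2) = PI / 2 * INR (fact (2 * n)).
Proof.
induction n as [|n IH].
- simpl. rewrite wallis_0. ring.
- assert (H := wallis_rec (2 * n)).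
  replace (2 * S n)%nat with (S (S (2 * n))) by lia.
  rewrite !fact_simpl, !mult_INR.
  replace (PI / 2 * (INR (S (S (2 * n))) * (INR (S (2 * n)) * INR (fact (2 * n)))))
    with (INR (S (S (2 * n))) * INR (S (2 * n)) * (PI / 2 * INR (fact (2 * n)))) by ring.
  rewrite <- IH.
  replace (INR (S (S (2 * n))) * INR (S (2 * n)) *
    (cos_int (2 * n) 0 * (4 ^ n * INR (fact n) ^ 2)))
    with (INR (S (S (2 * n))) * (INR (S (2 * n)) * cos_int (2 * n) 0) *
    (4 ^ n * INR (fact n) ^ 2)) by ring.
  rewrite <- H, !INR_SS, mult_INR, S_INR. change (INR 2) with 2. simpl. ring.
Qed.

(** * The exact formula for the cotangent sum *)

Lemma sum1_ext (f g : nat -> R) (n : nat) :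
  (forall k, (1 <= k <= n)%nat -> f k = g k) ->
  (sum_n_m f 1 n : R) = sum_n_m g 1 n.
Proof. exact (sum_n_m_ext_loc f g 1 n). Qed.

Lemma sum1_plus (f g : nat -> R) (n : nat) :
  (sum_n_m (fun k => f k + g k) 1 n : R) = (sum_n_m f 1 n : R) + sum_n_m g 1 n.
Proof. exact (sum_n_m_plus f g 1 n). Qed.

Lemma sum1_scal (c : R) (f : nat -> R) (n : nat) :
  (sum_n_m (fun k => c * f k) 1 n : R) = c * sum_n_m f 1 n.
Proof. exact (sum_n_m_mult_l (K := R_Ring) c f 1 n). Qed.

Lemma sum1_const (c : R) (n : nat) : (sum_n_m (fun _ => c) 1 n : R) = INR n * c.
Proof.
rewrite sum_n_m_const. now replace (S n - 1)%nat with n by lia.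
Qed.

Lemma sum1_inv_plus (N q : nat) :
  (sum_n_m (fun k => / (INR N + INR k)) 1 q : R) = harmonic (N + q) - harmonic N.
Proof.
induction q as [|q IH].
- rewrite sum1_0, Nat.add_0_r. ring.
- rewrite sum1_S, IH, Nat.add_succ_r, harmonic_S, <- plus_INR, Nat.add_succ_r. ring.
Qed.

Lemma sum1_inv_minus (n q : nat) : (q <= n)%nat ->
  (sum_n_m (fun k => / (INR (S n) - INR k)) 1 q : R) = harmonic n - harmonic (n - q).
Proof.
induction q as [|q IH]; intros Hq.
- rewrite sum1_0, Nat.sub_0_r. ring.
- rewrite sum1_S, IH, <- minus_INR by lia.
  replace (n - q)%nat with (S (n - S q)) by lia. rewrite harmonic_S.
  replace (S n - S q)%nat with (S (n - S q)) by lia. ring.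
Qed.

Definition cot_partial (x : R) (M : nat) : R :=
  / x + sum_n_m (fun k => 2 * x / (x ^ 2 - INR k ^ 2)) 1 M.

(** Summed over [k < p], the [j]-th partial fraction becomes [j] times differences of harmonic
    numbers between neighbouring multiples of [p]. Summation by parts over [j] then yields the right
    side, which is checked here by induction on [M]. *)
Lemma sum_cot_partial (p M : nat) : (1 <= p)%nat ->
  (sum_n_m (fun k => INR k * cot_partial (INR k / INR p) M) 1 (p - 1) : R)
  = 2 * INR p ^ 2 * sum_n_m (fun l => harmonic (l * p)) 1 M
    - (2 * INR M + 1) * INR p ^ 2 * harmonic (M * p)
    + (2 * INR M + 1) * INR p ^ 2
    - INR M * INR p ^ 2 * (harmonic (S M * p) - harmonic (M * p))
    - INR p * harmonic (S M).
Proof.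
intros Hp. destruct p as [|q]; [lia|]. clear Hp.
replace (S q - 1)%nat with q by lia. set (p := S q).
assert (HP : 0 < INR p) by apply INR_S_pos.
assert (Hk : forall k, (1 <= k <= q)%nat -> 0 < INR k < INR p).
{ intros k Hk. split; [apply lt_0_INR|apply lt_INR; unfold p]; lia. }
assert (Hq : INR q = INR p - 1) by (unfold p; rewrite S_INR; ring).
induction M as [|M IH].
- rewrite (sum1_ext _ (fun _ => INR p)).
  + rewrite sum1_const, sum1_0, Hq, harmonic_S, Nat.mul_0_l, harmonic_0. simpl INR.
    field.
  + intros k H. unfold cot_partial. rewrite sum1_0. specialize (Hk k H). field. lra.
(* With [j = M + 1], this splits [k] times the new term as [2 p - j p^2 (1 / (j p + k) + 1 / (j p -
   k))]; [S (M * p + q)] is [j p], written as a successor for [sum1_inv_minus]. *)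
- rewrite (sum1_ext _ (fun k => INR k * cot_partial (INR k / INR p) M
      + (2 * INR p + (- (INR (S M) * INR p ^ 2) * / (INR (S M * p) + INR k)
         + - (INR (S M) * INR p ^ 2) * / (INR (S (M * p + q)) - INR k))))).
  + rewrite !sum1_plus, !sum1_scal, sum1_const, sum1_inv_plus, sum1_inv_minus by lia.
    rewrite IH, sum1_S.
    replace (M * p + q - q)%nat with (M * p)%nat by lia.
    assert (E1 : harmonic (S (S M) * p) = harmonic (S M * p + q) + / INR (S (S M) * p)).
    { replace (S (S M) * p)%nat with (S (S M * p + q)) by (unfold p; lia).
      apply harmonic_S. }
    assert (E2 : harmonic (S M * p) = harmonic (M * p + q) + / INR (S M * p)).
    { replace (S M * p)%nat with (S (M * p + q)) by (unfold p; lia).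
      apply harmonic_S. }
    rewrite (harmonic_S (S M)), E1.
    replace (harmonic (M * p + q)) with (harmonic (S M * p) - / INR (S M * p)) by lra.
    rewrite Hq, !mult_INR, !S_INR.
    assert (HM := pos_INR M).
    match goal with |- @eq _ ?a ?b => change (@eq R a b) end.
    set (s := sum_n_m _ 1 M : R). field. lra.
  + intros k H. unfold cot_partial. rewrite sum1_S. specialize (Hk k H).
    replace (S (M * p + q)) with (S M * p)%nat by (unfold p; lia).
    rewrite mult_INR.
    assert (HM : 1 <= INR (S M)) by (rewrite S_INR; assert (H0 := pos_INR M); lra).
    assert (HMp : INR p <= INR (S M) * INR p).
    { rewrite <- (Rmult_1_l (INR p)) at 1. apply Rmult_le_compat_r; lra. }
    match goal with |- @eq _ ?a ?b => change (@eq R a b) end.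
    set (s := sum_n_m _ 1 M : R). set (j := INR (S M)) in *.
    assert (H1 : INR k ^ 2 - (j * INR p) ^ 2 < 0).
    { replace (INR k ^ 2 - (j * INR p) ^ 2)
        with (- ((j * INR p - INR k) * (j * INR p + INR k))) by ring.
      enough (0 < (j * INR p - INR k) * (j * INR p + INR k)) by lra.
      apply Rmult_lt_0_compat; lra. }
    field. repeat split; try lra.
Qed.

Lemma is_lim_seq_sum_cot_partial (p : nat) : (1 <= p)%nat ->
  is_lim_seq
    (fun M => sum_n_m (fun k => INR k * cot_partial (INR k / INR p) M) 1 (p - 1))
    (PI * J p).
Proof.
intros Hp. assert (HP : 0 < INR p) by (apply lt_0_INR; lia).
unfold J. rewrite <- sum1_scal.
apply (is_lim_seq_sum1 (fun k M => INR k * cot_partial (INR k / INR p) M)).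
intros k Hk. assert (Hk0 : 0 < INR k) by (apply lt_0_INR; lia).
assert (Hkp : INR k < INR p) by (apply lt_INR; lia).
replace (Finite (PI * (INR k * cot (INR k * PI / INR p))))
  with (Rbar_mult (INR k) (PI * cot (PI * (INR k / INR p)))).
- apply is_lim_seq_scal_l. apply cot_partial_fractions. split.
  + now apply Rdiv_lt_0_compat.
  + apply (Rmult_lt_reg_r (INR p)); [exact HP|].
    unfold Rdiv. rewrite Rmult_assoc, Rinv_l by lra. lra.
- simpl. f_equal. replace (PI * (INR k / INR p)) with (INR k * PI / INR p)
    by (field; lra). ring.
Qed.

(** The logarithm of the ratio of [n!] to [n^(n + 1/2) e^(-n)], whose convergence is Stirling's
    formula. *)
Definition log_fact_rem (n : nat) : R :=
  ln (INR (fact n)) - (INR n + / 2) * ln (INR n) + INR n.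

Lemma sum_harmonic_mult (p M : nat) : (1 <= p)%nat ->
  (sum_n_m (fun l => harmonic (l * p)) 1 M : R)
  = (sum_n_m (fun l => harmonic_rem (l * p)) 1 M : R) + ln (INR (fact M))
    + INR M * ln (INR p) + INR M * euler_gamma + harmonic M / (2 * INR p).
Proof.
intros Hp. assert (HP : 0 < INR p) by (apply lt_0_INR; lia).
induction M as [|M IH].
- rewrite !sum1_0, harmonic_0. simpl. rewrite ln_1. field. lra.
- rewrite !sum1_S, IH, harmonic_S, fact_simpl.
  change (harmonic_rem (S M * p)) with (harmonic (S M * p)
    - ln (INR (S M * p)) - euler_gamma - / (2 * INR (S M * p))).
  assert (HM := INR_S_pos M).
  rewrite !mult_INR, !ln_mult by (auto; apply INR_fact_lt_0).
  rewrite S_INR in *.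
  match goal with |- @eq _ ?a ?b => change (@eq R a b) end.
  set (s := sum_n_m _ 1 M : R). field. lra.
Qed.

(** The case [m = 1] of the remainder estimates, where the correcting sum is empty. *)
Lemma harmonic_rem_bound :
  exists C, forall n, (1 <= n)%nat -> Rabs (harmonic_rem n) <= C / INR n ^ 2.
Proof.
destruct is_bernoulli_exists as [B HB].
exists (Rabs (bernoulli_number B 2) / 2). intros n Hn.
assert (H1 := bernoulli_rem_sign B 1 n HB ltac:(lia) Hn).
assert (H2 := bernoulli_rem_bound B 1 n HB ltac:(lia) Hn).
unfold bernoulli_rem in H1, H2. change (1 - 1)%nat with 0%nat in *.
rewrite sum1_0 in *. change (2 * 1)%nat with 2%nat in *.
assert (HN : 0 < INR n) by (apply lt_0_INR; lia).
change (INR 2) with 2 in H2.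
replace (Rabs (bernoulli_number B 2) / 2 / INR n ^ 2)
  with (Rabs (bernoulli_number B 2) / (2 * INR n ^ 2)) by (field; lra).
rewrite Rabs_left; lra.
Qed.

Lemma is_lim_seq_mult_harmonic_rem (p : nat) : (1 <= p)%nat ->
  is_lim_seq (fun n => INR n * harmonic_rem (n * p)) 0.
Proof.
intros Hp. destruct harmonic_rem_bound as [C HC].
apply is_lim_seq_incr_1, is_lim_seq_abs_0.
apply (is_lim_seq_le_le (fun _ => 0) _ (fun n => C * / INR (S n))).
- intros n. split; [apply Rabs_pos|].
  assert (H := HC (S n * p)%nat ltac:(nia)).
  assert (HN := INR_S_pos n).
  assert (HP : 1 <= INR p) by (apply (le_INR 1); lia).
  assert (HC0 : 0 <= C).
  { assert (H1 := HC 1%nat (le_n 1)). assert (H2 := Rabs_pos (harmonic_rem 1)).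
    simpl in H1. lra. }
  rewrite Rabs_mult, (Rabs_pos_eq (INR (S n))) by lra.
  apply Rle_trans with (INR (S n) * (C / INR (S n * p) ^ 2)).
  + apply Rmult_le_compat_l; lra.
  + rewrite mult_INR.
    replace (INR (S n) * (C / (INR (S n) * INR p) ^ 2))
      with (C * (/ INR (S n) * / INR p ^ 2)) by (field; lra).
    apply Rmult_le_compat_l; [exact HC0|].
    rewrite <- (Rmult_1_r (/ INR (S n))) at 2.
    apply Rmult_le_compat_l; [now apply Rlt_le, Rinv_0_lt_compat|].
    rewrite <- Rinv_1. apply Rinv_le_contravar; [lra|]. nra.
- apply is_lim_seq_const.
- replace (Finite 0) with (Rbar_mult C 0) by (simpl; f_equal; ring).
  apply is_lim_seq_scal_l. apply (is_lim_seq_incr_1 (fun n => / INR n)).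
  exact is_lim_seq_inv_INR.
Qed.

Lemma is_lim_seq_harmonic_rem_mult (p : nat) : (1 <= p)%nat ->
  is_lim_seq (fun n => harmonic_rem (n * p)) 0.
Proof.
intros Hp. apply (is_lim_seq_subseq harmonic_rem 0 (fun n => (n * p)%nat)).
- apply eventually_subseq. intros n. nia.
- exact is_lim_seq_harmonic_rem.
Qed.

Lemma is_lim_seq_inv_INR_S : is_lim_seq (fun n => / INR (S n)) 0.
Proof.
apply (is_lim_seq_incr_1 (fun n => / INR n)). exact is_lim_seq_inv_INR.
Qed.

Lemma is_lim_seq_mult_ln_S :
  is_lim_seq (fun n => INR n * (ln (INR (S n)) - ln (INR n))) 1.
Proof.
apply is_lim_seq_incr_1.
apply (is_lim_seq_le_le (fun n => 1 - / INR (S (S n))) _ (fun _ => 1)).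
- intros n. destruct (ln_S_bounds (S n)) as [H1 H2]; [lia|].
  assert (H := INR_S_pos n). assert (H' := INR_S_pos (S n)).
  apply (Rmult_le_compat_l (INR (S n))) in H1; [|lra].
  apply (Rmult_le_compat_l (INR (S n))) in H2; [|lra].
  rewrite Rinv_r in H2 by lra. split; [|exact H2].
  apply (Rle_trans _ (INR (S n) * / INR (S (S n)))); [|exact H1].
  rewrite (S_INR (S n)) in *. apply Req_le. field. lra.
- replace (Finite 1) with (Finite (1 - 0)) by (f_equal; ring).
  apply is_lim_seq_minus'; [apply is_lim_seq_const|].
  apply (is_lim_seq_incr_1 (fun n => / INR (S n))). exact is_lim_seq_inv_INR_S.
- apply is_lim_seq_const.
Qed.

(** Solves [sum_cot_partial] for the sum of the [harmonic_rem (l * p)]. The divergent parts combine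
    into [log_fact_rem M], so only the joint limit is available until Stirling's formula is
    known. *)
Lemma is_lim_seq_harmonic_rem_log_fact (p : nat) : (1 <= p)%nat ->
  is_lim_seq
    (fun M => sum_n_m (fun l => harmonic_rem (l * p)) 1 M + log_fact_rem M)
    ((PI * J p / INR p ^ 2 + ln (INR p) + euler_gamma + / INR p) / 2).
Proof.
intros Hp. assert (HP : 0 < INR p) by (apply lt_0_INR; lia).
set (u := fun n => INR n * harmonic_rem (n * p)).
set (d := fun n => harmonic_rem (n * p)).
set (A := fun M => sum_n_m (fun k => INR k * cot_partial (INR k / INR p) M) 1 (p - 1) : R).
(* What is left of [2 * (sum + log_fact_rem)] after removing [A / p^2 + ln p + gamma]. Its limit is
   [1 / p]: the logarithmic difference tends to 1 and cancels the final [- 1]. *)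
set (E := fun n => 2 * u n + d n + / INR p * (/ 2 * / INR n) + / INR p * / INR (S n)
   + (u (S n) - d (S n) - u n) + INR n * (ln (INR (S n)) - ln (INR n))
   + (/ INR p - / (2 * INR p) * / INR (S n)) - 1).
assert (Hu : is_lim_seq u 0) by now apply is_lim_seq_mult_harmonic_rem.
assert (Hd : is_lim_seq d 0) by now apply is_lim_seq_harmonic_rem_mult.
assert (Hu' := proj1 (is_lim_seq_incr_1 u 0) Hu).
assert (Hd' := proj1 (is_lim_seq_incr_1 d 0) Hd).
assert (HE : is_lim_seq E (2 * 0 + 0 + / INR p * (/ 2 * 0) + / INR p * 0
   + (0 - 0 - 0) + 1 + (/ INR p - / (2 * INR p) * 0) - 1)).
{ pose proof (is_lim_seq_scal_l _ 2 0 Hu : is_lim_seq _ (Finite (2 * 0))).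
  pose proof (is_lim_seq_scal_l _ (/ 2) 0 is_lim_seq_inv_INR
    : is_lim_seq _ (Finite (/ 2 * 0))) as H2.
  pose proof (is_lim_seq_scal_l _ (/ INR p) _ H2
    : is_lim_seq _ (Finite (/ INR p * (/ 2 * 0)))).
  pose proof (is_lim_seq_scal_l _ (/ INR p) 0 is_lim_seq_inv_INR_S
    : is_lim_seq _ (Finite (/ INR p * 0))).
  pose proof (is_lim_seq_scal_l _ (/ (2 * INR p)) 0 is_lim_seq_inv_INR_S
    : is_lim_seq _ (Finite (/ (2 * INR p) * 0))).
  unfold E.
  repeat first [ assumption | apply is_lim_seq_mult_ln_S | apply is_lim_seq_const
    | apply is_lim_seq_minus' | apply is_lim_seq_plus' ]. }
assert (HA : is_lim_seq A (PI * J p)) by now apply is_lim_seq_sum_cot_partial.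
apply is_lim_seq_incr_1.
apply (is_lim_seq_ext (fun M => / 2 * (/ INR p ^ 2 * A (S M)
  + (ln (INR p) + euler_gamma) + E (S M)))).
- intros M. unfold A. rewrite sum_cot_partial by exact Hp.
  rewrite sum_harmonic_mult by exact Hp.
  unfold E, u, d, log_fact_rem.
  assert (HM := INR_S_pos M). assert (HM' := INR_S_pos (S M)).
  assert (K : forall l, (1 <= l)%nat -> harmonic (l * p) =
    harmonic_rem (l * p) + ln (INR l) + ln (INR p) + euler_gamma
    + / (2 * INR l * INR p)).
  { intros l Hl. assert (0 < INR l) by (apply lt_0_INR; lia).
    unfold harmonic_rem. rewrite mult_INR, ln_mult by auto. field. lra. }
  rewrite (K (S M)), (K (S (S M))) by lia.
  rewrite (harmonic_S (S M)). rewrite (S_INR (S M)) in *.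
  match goal with |- @eq _ ?a ?b => change (@eq R a b) end.
  set (s := sum_n_m _ 1 (S M) : R). set (m := INR (S M)) in *.
  field. lra.
- replace (Finite _) with (Finite (/ 2 * (/ INR p ^ 2 * (PI * J p)
    + (ln (INR p) + euler_gamma) + (2 * 0 + 0 + / INR p * (/ 2 * 0) + / INR p * 0
    + (0 - 0 - 0) + 1 + (/ INR p - / (2 * INR p) * 0) - 1))))
    by (f_equal; field; lra).
  apply (is_lim_seq_scal_l _ (/ 2) (Finite _)).
  apply is_lim_seq_plus'; [apply is_lim_seq_plus'|].
  + apply (is_lim_seq_scal_l _ (/ INR p ^ 2) (Finite _)).
    now apply (is_lim_seq_incr_1 A).
  + apply is_lim_seq_const.
  + now apply (is_lim_seq_incr_1 E).
Qed.

(** * Convergent series, zeta values and Stirling's constant *)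

Lemma sum_n_shift (f : nat -> R) (n : nat) :
  (sum_n (fun k => f (S k)) n : R) = sum_n_m f 1 (S n).
Proof. exact (sum_n_m_S f 0 n). Qed.

Lemma is_series_shift (f : nat -> R) (l : R) :
  is_series (fun n => f (S n)) l <-> is_lim_seq (fun n => sum_n_m f 1 n) l.
Proof.
rewrite (is_lim_seq_incr_1 (fun n => sum_n_m f 1 n)).
split; intros H.
- apply (is_lim_seq_ext (sum_n (fun n => f (S n)))); [exact (sum_n_shift f)|exact H].
- exact (is_lim_seq_ext _ _ _ (fun n => eq_sym (sum_n_shift f n)) H).
Qed.

Lemma ex_series_inv_sqr : ex_series (fun n => / INR (S n) ^ 2).
Proof.
assert (H : ex_finite_lim_seq (fun n => sum_n_m (fun n => / INR n ^ 2) 1 n)).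
{ apply (ex_finite_lim_seq_incr _ 2).
  - intros n. rewrite sum1_S.
    assert (0 < / INR (S n) ^ 2) by apply Rinv_0_lt_compat, pow_lt, INR_S_pos. lra.
  - intros [|n]; [rewrite sum1_0; lra|].
    (* The stronger bound [2 - 1 / (n+1)] telescopes, as [1 / (j+1)^2 <= 1 / j - 1 / (j+1)]. *)
    apply Rle_trans with (2 - / INR (S n));
      [|assert (H := Rinv_0_lt_compat _ (INR_S_pos n)); lra].
    induction n as [|n IH].
    + rewrite sum1_S, sum1_0. simpl. lra.
    + rewrite sum1_S. apply Rle_trans with (2 - / INR (S n) + / INR (S (S n)) ^ 2);
        [lra|].
      assert (H := INR_S_pos n). rewrite (S_INR (S n)). set (j := INR (S n)) in *.
      enough (0 <= / j - / (j + 1) - / (j + 1) ^ 2) by lra.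
      replace (/ j - / (j + 1) - / (j + 1) ^ 2) with (/ (j * (j + 1) ^ 2))
        by (field; lra).
      apply Rlt_le, Rinv_0_lt_compat, Rmult_lt_0_compat; [lra|apply pow_lt; lra]. }
destruct H as [l Hl]. exists l. now apply (is_series_shift (fun n => / INR n ^ 2)).
Qed.

Lemma is_series_zeta (k : nat) : (1 <= k)%nat ->
  is_series (fun n => / INR (S n) ^ (2 * k)) (zeta (INR (2 * k))).
Proof.
intros Hk. unfold zeta.
rewrite (Series_ext _ (fun n => / INR (S n) ^ (2 * k))).
2: { intros n. rewrite Rpower_pow by apply INR_S_pos. reflexivity. }
apply Series_correct.
apply (ex_series_le (V := R_CompleteNormedModule) _ (fun n => / INR (S n) ^ 2));
  [|exact ex_series_inv_sqr].
intros n. change (Rabs (/ INR (S n) ^ (2 * k)) <= / INR (S n) ^ 2).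
assert (H := INR_S_pos n).
rewrite Rabs_pos_eq by now apply Rlt_le, Rinv_0_lt_compat, pow_lt.
apply Rinv_le_contravar; [now apply pow_lt|].
apply Rle_pow; [apply (le_INR 1)|]; lia.
Qed.

(** Taking logarithms in [wallis_fact], all terms growing with [n] cancel except half the logarithm
    of the convergent sequence of [is_lim_seq_wallis]. *)
Lemma is_lim_seq_wallis_log_fact :
  is_lim_seq (fun n => 2 * log_fact_rem n - log_fact_rem (2 * n)) (ln (2 * PI) / 2).
Proof.
assert (HPI := PI_RGT_0).
assert (HW := is_lim_seq_wallis).
apply is_lim_seq_incr_1 in HW. apply is_lim_seq_incr_1.
apply (is_lim_seq_continuous ln) in HW.
2: { apply continuity_pt_filterlim, continuous_ln. lra. }
apply (is_lim_seq_ext (fun n => ln (PI / 2) + ln 2 / 2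
  - / 2 * ln (INR (S n) * cos_int (2 * S n) 0 ^ 2))).
- intros n. assert (F := wallis_fact (S n)). apply (f_equal ln) in F.
  assert (Hc := wallis_pos (2 * S n)). assert (Hn := INR_S_pos n).
  assert (Hf := fun k => INR_fact_lt_0 k).
  assert (H4 : 0 < 4 ^ S n) by (apply pow_lt; lra).
  assert (Hf2 := pow_lt _ 2 (Hf (S n))).
  rewrite !ln_mult in F
    by (auto; try apply Rmult_lt_0_compat; auto; lra).
  rewrite !ln_pow in F by (auto; lra).
  rewrite ln_mult, ln_pow by (auto; now apply pow_lt).
  replace 4 with (2 * 2) in F by ring. rewrite ln_mult in F by lra.
  unfold log_fact_rem. rewrite (mult_INR 2 (S n)).
  change (INR 2) with 2 in *. rewrite (ln_mult 2 (INR (S n))) by lra. lra.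
- replace (Finite (ln (2 * PI) / 2))
    with (Finite (ln (PI / 2) + ln 2 / 2 - / 2 * ln (PI / 4))).
  + apply is_lim_seq_minus'; [apply is_lim_seq_const|].
    now apply (is_lim_seq_scal_l _ (/ 2) (Finite _)).
  + f_equal. unfold Rdiv. rewrite !ln_mult, !ln_Rinv by lra.
    replace 4 with (2 * 2) by ring. rewrite ln_mult by lra. field.
Qed.

(** The case [p = 1] of the joint limit, together with convergence of the series of [harmonic_rem],
    gives some limit [c]; passing to the limit in [2 * log_fact_rem n - log_fact_rem (2 * n)]
    identifies it, as [2 c - c = c]. *)
Lemma is_lim_seq_log_fact_rem : is_lim_seq log_fact_rem (ln (2 * PI) / 2).
Proof.
destruct harmonic_rem_bound as [C HC].
assert (HS : ex_series (fun n => harmonic_rem (S n))).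
{ apply (ex_series_le (V := R_CompleteNormedModule) _ (fun n => C * / INR (S n) ^ 2)).
  - intros n. apply (HC (S n)). lia.
  - apply (ex_series_scal C (fun n => / INR (S n) ^ 2)), ex_series_inv_sqr. }
destruct HS as [s Hs]. apply is_series_shift in Hs.
assert (H1 := is_lim_seq_harmonic_rem_log_fact 1 (le_n 1)).
assert (H2 := is_lim_seq_minus' _ _ _ _ H1 Hs).
apply (is_lim_seq_ext _ log_fact_rem) in H2.
2: { intros n. rewrite (sum1_ext (fun l => harmonic_rem (l * 1)) harmonic_rem).
     - match goal with |- @eq _ ?a ?b => change (@eq R a b) end. ring.
     - intros k _. now rewrite Nat.mul_1_r. }
set (c := _ - s) in H2.
enough (E : c = ln (2 * PI) / 2) by now rewrite <- E.
assert (H3 : is_lim_seq (fun n => 2 * log_fact_rem n - log_fact_rem (2 * n)) (2 * c - c)).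
{ apply is_lim_seq_minus'.
  - now apply (is_lim_seq_scal_l _ 2 c).
  - apply (is_lim_seq_subseq log_fact_rem c (fun n => (2 * n)%nat)); [|exact H2].
    apply eventually_subseq. intros n. lia. }
assert (H4 := is_lim_seq_unique _ _ H3).
rewrite (is_lim_seq_unique _ _ is_lim_seq_wallis_log_fact) in H4.
injection H4. lra.
Qed.

(** The exact formula of the overview, solved for the sum of [D (n p)]. *)
Lemma is_series_harmonic_rem_mult (p : nat) : (1 <= p)%nat ->
  is_series (fun n => harmonic_rem (S n * p))
    ((PI * J p / INR p ^ 2 + ln (INR p) + euler_gamma + / INR p - ln (2 * PI)) / 2).
Proof.
intros Hp. apply (is_series_shift (fun n => harmonic_rem (n * p))).
set (c := _ + / INR p).
replace ((c - ln (2 * PI)) / 2) with (c / 2 - ln (2 * PI) / 2) by field.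
assert (H := is_lim_seq_minus' _ _ _ _
  (is_lim_seq_harmonic_rem_log_fact p Hp) is_lim_seq_log_fact_rem).
refine (is_lim_seq_ext _ _ _ _ H). intros n.
match goal with |- @eq _ ?a ?b => change (@eq R a b) end. ring.
Qed.

Lemma is_series_sum1 (f : nat -> nat -> R) (l : nat -> R) (m : nat) :
  (forall k, (1 <= k <= m)%nat -> is_series (f k) (l k)) ->
  is_series (fun n => sum_n_m (fun k => f k n) 1 m) (sum_n_m l 1 m : R).
Proof.
induction m as [|m IH]; intros H.
(* The zero series is obtained as [0] times a convergent series. *)
- rewrite sum1_0. apply (is_series_ext (fun n => 0 * / INR (S n) ^ 2)).
  + intros n. rewrite sum1_0. apply Rmult_0_l.
  + destruct ex_series_inv_sqr as [s Hs].
    apply (is_series_scal 0) in Hs. evar_last; [exact Hs|]. apply Rmult_0_l.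
- rewrite sum1_S.
  apply (is_series_ext (fun n => (sum_n_m (fun k => f k n) 1 m : R) + f (S m) n)).
  + intros n. now rewrite sum1_S.
  + apply (is_series_plus (fun n => sum_n_m (fun k => f k n) 1 m : R) (f (S m)));
      [apply IH|apply H]; intros; [apply H|]; lia.
Qed.

Lemma is_series_pos (a : nat -> R) (l : R) :
  (forall n, 0 < a n) -> is_series a l -> 0 < l.
Proof.
intros Ha Hl. apply Rlt_le_trans with (1 := Ha O).
apply (is_lim_seq_le (fun _ => a O) (sum_n a) (a O) l).
- intros n. induction n as [|n IH]; [rewrite sum_n_OR; lra|].
  rewrite sum_n_SR. specialize (Ha (S n)). lra.
- apply is_lim_seq_const.
- exact Hl.
Qed.

Lemma is_series_inv_mult_pow (p k : nat) (b c : R) :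
  (1 <= p)%nat -> (1 <= k)%nat -> c <> 0 ->
  is_series (fun n => b / (c * INR (S n * p) ^ (2 * k)))
    (b * zeta (INR (2 * k)) / (c * INR p ^ (2 * k))).
Proof.
intros Hp Hk Hc. assert (HP : 0 < INR p ^ (2 * k)) by (apply pow_lt, lt_0_INR; lia).
assert (H := is_series_scal (b / (c * INR p ^ (2 * k))) _ _ (is_series_zeta k Hk)).
evar_last.
- eapply is_series_ext; [|exact H]. intros n. cbv beta.
  change (b / (c * INR p ^ (2 * k)) * / INR (S n) ^ (2 * k)
          = b / (c * INR (S n * p) ^ (2 * k))).
  rewrite mult_INR, Rpow_mult_distr.
  assert (0 < INR (S n) ^ (2 * k)) by apply pow_lt, INR_S_pos.
  field. lra.
- change (b / (c * INR p ^ (2 * k)) * zeta (INR (2 * k))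
    = b * zeta (INR (2 * k)) / (c * INR p ^ (2 * k))).
  field. lra.
Qed.

Theorem proposition11p7 (B : nat -> R -> R) (HB : is_bernoulli B)
    (p m : nat) (hp : (2 <= p)%nat) (hm : (1 <= m)%nat) :
  exists eps : R,
    0 < eps < Rabs (bernoulli_number B (2 * m)) /\
    PI * J p =
      - (INR p) ^ 2 * ln (INR p)
      + (ln (2 * PI) - euler_gamma) * (INR p) ^ 2
      - INR p
      - sum_n_m (fun k => bernoulli_number B (2 * k) * zeta (INR (2 * k))
                          / (INR k * INR p ^ (2 * k - 2))) 1 (m - 1)
      + (-1) ^ m * (zeta (INR (2 * m)) / (INR m * INR p ^ (2 * m - 2))) * eps.
Proof.
assert (Hp : (1 <= p)%nat) by lia.
assert (HP : 0 < INR p) by (apply lt_0_INR; lia).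
assert (HM : 0 < INR m) by (apply lt_0_INR; lia).
assert (H2k : forall k, INR (2 * k) = 2 * INR k)
  by (intros k; now rewrite mult_INR).
set (L := (PI * J p / INR p ^ 2 + ln (INR p) + euler_gamma + / INR p
           - ln (2 * PI)) / 2).
set (S1 := sum_n_m (fun k => B (2 * k)%nat 0 * zeta (INR (2 * k))
  / (INR (2 * k) * INR p ^ (2 * k))) 1 (m - 1) : R).
(* Summing over multiples of [p] turns each [1 / (n p)^(2k)] into [zeta(2k) / p^(2k)]; [L] is the
   sum of [D (n p)] and [S1] that of the added Bernoulli terms. *)
assert (HR : is_series (fun n => bernoulli_rem B m (S n * p)) (L + S1)).
{ apply (is_series_plus (fun n => harmonic_rem (S n * p))
    (fun n => sum_n_m (fun k => B (2 * k)%nat 0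
      / (INR (2 * k) * INR (S n * p) ^ (2 * k))) 1 (m - 1) : R)).
  - now apply is_series_harmonic_rem_mult.
  - apply (is_series_sum1 (fun k n => B (2 * k)%nat 0
      / (INR (2 * k) * INR (S n * p) ^ (2 * k)))).
    intros k Hk. apply is_series_inv_mult_pow; [lia|lia|].
    apply not_0_INR. lia. }
apply (is_series_scal ((-1) ^ m)) in HR.
change (scal ((-1) ^ m) (L + S1)) with ((-1) ^ m * (L + S1)) in HR.
set (T := (-1) ^ m * (L + S1)) in *.
set (b := Rabs (bernoulli_number B (2 * m))).
set (z := zeta (INR (2 * m))).
assert (HZ : 0 < z).
{ apply (is_series_pos _ _ (fun n => Rinv_0_lt_compat _ (pow_lt _ (2 * m) (INR_S_pos n)))).
  now apply is_series_zeta. }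
assert (Hq : 0 < INR p ^ (2 * m)) by now apply pow_lt.
assert (HT0 : 0 < T).
{ refine (is_series_pos _ _ _ HR). intros n.
  apply bernoulli_rem_sign; [auto|auto|nia]. }
(* The termwise strict bound stays strict after summation, because the differences form a series of
   positive terms. *)
assert (HT1 : 0 < b * z / (INR (2 * m) * INR p ^ (2 * m)) - T).
{ assert (H := is_series_minus _ _ _ _
    (is_series_inv_mult_pow p m b (INR (2 * m)) Hp hm ltac:(apply not_0_INR; lia)) HR).
  refine (is_series_pos _ _ _ H). intros n.
  apply Rlt_0_minus, bernoulli_rem_bound; [auto|auto|nia]. }
(* Chosen so that [T = z * eps / (2m p^(2m))]; the bounds on [eps] are then [HT0] and [HT1]. *)
exists (T * (INR (2 * m) * INR p ^ (2 * m)) / z).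
rewrite H2k in *.
assert (HK : 0 < 2 * INR m * INR p ^ (2 * m)) by (apply Rmult_lt_0_compat; lra).
split; [split|].
- apply Rdiv_lt_0_compat; [now apply Rmult_lt_0_compat|exact HZ].
- apply (Rmult_lt_reg_r (z / (2 * INR m * INR p ^ (2 * m))));
    [now apply Rdiv_lt_0_compat|].
  replace (T * (2 * INR m * INR p ^ (2 * m)) / z * (z / (2 * INR m * INR p ^ (2 * m))))
    with T by (field; lra).
  unfold Rdiv in *. lra.
- set (S2 := sum_n_m _ 1 (m - 1) : R).
  (* The factor [2 p^2] converts [2k p^(2k)] into [k p^(2k-2)]; the natural subtraction is exact
     since [k >= 1]. *)
  assert (E : S2 = 2 * INR p ^ 2 * S1).
  { unfold S1, S2. rewrite <- sum1_scal. apply sum1_ext. intros k Hk.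
    rewrite !H2k. unfold bernoulli_number.
    replace (INR p ^ (2 * k)) with (INR p ^ 2 * INR p ^ (2 * k - 2))
      by (rewrite <- pow_add; f_equal; lia).
    assert (0 < INR k) by (apply lt_0_INR; lia).
    assert (0 < INR p ^ (2 * k - 2)) by now apply pow_lt.
    field. lra. }
  change (PI * J p = - INR p ^ 2 * ln (INR p) + (ln (2 * PI) - euler_gamma) * INR p ^ 2
    - INR p - S2 + (-1) ^ m * (z / (INR m * INR p ^ (2 * m - 2)))
      * (T * (2 * INR m * INR p ^ (2 * m)) / z)).
  rewrite E.
  replace (INR p ^ (2 * m)) with (INR p ^ 2 * INR p ^ (2 * m - 2))
    by (rewrite <- pow_add; f_equal; lia).
  assert (0 < INR p ^ (2 * m - 2)) by now apply pow_lt.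
  (* The sign in the statement meets the one in [T], leaving [2 p^2 (L + S1)]; its [S1] part cancels
     the Bernoulli sum. *)
  replace ((-1) ^ m * (z / (INR m * INR p ^ (2 * m - 2)))
      * (T * (2 * INR m * (INR p ^ 2 * INR p ^ (2 * m - 2))) / z))
    with ((-1) ^ m * (-1) ^ m * (2 * INR p ^ 2 * (L + S1)))
    by (unfold T; field; lra).
  rewrite pow_m1_sqr. unfold L. field. lra.
Qed.
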